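(* Let $f:\mathbb{R}^d\to\mathbb{R}$ be $\mu$-strongly convex ($\mu>0$) and $L$-smooth ($0<L<\infty$), and let $f^*$ be the minimum of $f$ over $\mathbb{R}^d$. Let $\{x_k\}_{k\in\mathbb{N}}$ be generated by stochastic gradient descent $x_{k+1}=x_k-\eta_k\, g(x_k;\xi_k)$, $k\in\mathbb{N}$, from $x_0\in\mathbb{R}^d$, where the stochastic gradients satisfy, for all $k\in\mathbb{N}$, $$\mathbb{E}\left[g(x_k;\xi_k)\mid\mathcal{F}_k\right]=\nabla f(x_k)\quad\text{and}\quad \mathbb{E}\left[\exp\left(t\|g(x_k;\xi_k)-\nabla f(x_k)\|^2\right)\mid\mathcal{F}_k\right]\le\frac{1}{\sqrt{1-2t}}\quad\forall t\in\left(0,\tfrac12\right).$$ For $k\in\mathbb{N}$ set $$\eta_k=\frac{4}{\mu(k+B)},\qquad t_k=\frac{\mu(k+B-1)}{16},\qquad\text{where } B:=\max\left\{\frac{4L}{\mu},3\right\}.$$ Let $\Delta_k:=f(x_k)-f^*$. Then for any $\beta\in\left(0,\frac{6}{\pi^2}\right)$, $$\mathbb{P}\left(\Delta_k\le\frac{16\mu\log\left((\log_2 k+1)^2/\beta\right)+\mu^2B\Delta_0+32L}{\mu^2(k+B-1)},\ \forall k\in\mathbb{N}_+\right)\ge 1-\frac{\pi^2\beta}{6}.$$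
   Context: $\mathbb{N}=\{0,1,2,\dots\}$ and $\mathbb{N}_+=\{1,2,\dots\}$. $L$-smoothness of $f$ means that $f$ is differentiable and $\|\nabla f(x)-\nabla f(y)\|\le L\|x-y\|$ for all $x,y\in\mathbb{R}^d$. The starting point $x_0\in\mathbb{R}^d$ is deterministic. $\xi_0,\xi_1,\dots$ are the random elements driving the stochastic gradients $g(x_k;\xi_k)\in\mathbb{R}^d$; $\mathcal{F}_k=\sigma(\xi_0,\dots,\xi_{k-1})$ for $k\ge1$ and $\mathcal{F}_0$ is the trivial $\sigma$-algebra. $\log$ is the natural logarithm and $\|\cdot\|$ the Euclidean norm. *)

(* Defs.v *)
From HB Require Import structures.
From mathcomp Require Import all_boot all_order all_algebra.
From mathcomp Require Import all_classical all_reals all_analysis.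

Set Implicit Arguments.
Unset Strict Implicit.
Unset Printing Implicit Defensive.

Import Order.TTheory GRing.Theory Num.Theory.
Import numFieldNormedType.Exports.

Local Open Scope classical_set_scope.
Local Open Scope ring_scope.

(* The library's norm on row vectors is the sup norm, hence this one. The two
   induce the same topology, so [differentiable] needs no counterpart. *)
Definition enorm (R : realType) (d : nat) (v : 'rV[R]_d) : R :=
  Num.sqrt (\sum_(i < d) v 0 i ^+ 2).

(* The partial derivatives; they represent ['d f x] when [f] is differentiable
   at [x], which is the only case where this is used. *)
Definition grad (R : realType) (d : nat) (f : 'rV[R]_d -> R) (x : 'rV[R]_d) :
    'rV[R]_d :=
  \row_(i < d) 'D_(delta_mx 0 i) f x.

Definition strongly_convex (R : realType) (d : nat) (mu : R)
    (f : 'rV[R]_d -> R) : Prop :=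
  forall (x y : 'rV[R]_d) (a : R), 0 <= a <= 1 ->
    f (a *: x + (1 - a) *: y) <=
      a * f x + (1 - a) * f y - mu / 2 * a * (1 - a) * enorm (x - y) ^+ 2.

Definition smooth (R : realType) (d : nat) (L : R) (f : 'rV[R]_d -> R) : Prop :=
  (forall x, differentiable f x) /\
  (forall x y, enorm (grad f x - grad f y) <= L * enorm (x - y)).

Definition is_minimum (R : realType) (T : Type) (f : T -> R) (m : R) : Prop :=
  (exists x, f x = m) /\ (forall x, m <= f x).

(* sigma(xi_0, ..., xi_(k-1)); for k = 0 the generating family is empty and the
   result is the trivial sigma-algebra. *)
Definition past (dO dX : measure_display) (Omega : measurableType dO)
    (X : measurableType dX) (xi : nat -> Omega -> X) (k : nat) :
    set (set Omega) :=
  <<s \bigcup_(i in `I_k) preimage_set_system setT (xi i) measurable >>.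

Definition measurable_wrt (R : realType) (T : Type) (F : set (set T))
    (Z : T -> R) : Prop :=
  preimage_set_system setT Z measurable `<=` F.

(* Z is a version of E[Y | F], for an integrable Y and a sub-sigma-algebra F. *)
Definition is_condexp (dO : measure_display) (Omega : measurableType dO)
    (R : realType) (P : probability Omega R) (F : set (set Omega))
    (Y Z : Omega -> R) : Prop :=
  [/\ P.-integrable setT (EFin \o Y),
      P.-integrable setT (EFin \o Z),
      measurable_wrt F Z &
      forall A, F A ->
        (\int[P]_(w in A) (Y w)%:E = \int[P]_(w in A) (Z w)%:E)%E].

(* E[Y | F] <= c almost surely; versions agree almost surely, so it does not
   matter which one is taken. *)
Definition condexp_le (dO : measure_display) (Omega : measurableType dO)
    (R : realType) (P : probability Omega R) (F : set (set Omega))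
    (Y : Omega -> R) (c : R) : Prop :=
  exists2 Z : Omega -> R, is_condexp P F Y Z & {ae P, forall w, Z w <= c}.

(* Main.v *)
(* With kappa = k + B - 1 and V_k = t_k Delta_k, the descent lemma and the
   Polyak-Lojasiewicz inequality bound V_{k+1} by
     (1 - 1/kappa) V_k + <a, z> + s |z|^2 - 3 |a|^2,
   where z is the gradient noise, a is known at time k, and
   s = L / (2 mu (k + B)) <= 1/8.  The light tail gives
   E exp(<b, z>) <= exp(2 |b|^2), whence by Young's inequality
     E[exp V_{k+1} | F_k] <= exp((1 - 1/kappa) V_k + L / (mu (k + B))).
   The contraction and the convexity of exp keep E exp V_k below
   exp(V_0 + L / mu) for all k.  On a dyadic block 2^j <= k < 2^(j+1) the drift
   adds up to at most L / mu, so exp(V_k) minus the drift is a supermartingale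
   there and its maximal inequality bounds the failure probability of the block
   by beta / (j + 1)^2; these sum to at most beta pi^2 / 6. *)

Require Import Defs.
From HB Require Import structures.
From mathcomp Require Import all_boot all_order all_algebra.
From mathcomp Require Import all_classical all_reals all_analysis.
From mathcomp Require Import measurable_realfun.
From mathcomp Require Import ring lra zify.

Set Implicit Arguments.
Unset Strict Implicit.
Unset Printing Implicit Defensive.

Import Order.TTheory GRing.Theory Num.Theory.
Import numFieldNormedType.Exports.

Local Open Scope classical_set_scope.
Local Open Scope ring_scope.

(** * Exponential inequalities *)

(** The drifts [L / (mu (k + B))] form a divergent series, so no single drift-corrected
    supermartingale serves all times, and a union bound over all [k] would put [log k] where the
    theorem has [log_2 k + 1] under the logarithm only. Hence the dyadic blocks, each restarted from
    the uniform moment bound that the contraction provides.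

    The light tail is given for deterministic [t], while the vector paired with the noise is random.
    Convexity of [exp] removes the mismatch: a random exponent becomes a random weight, known at
    time [k], on [exp(t |z|^2)] with [t] fixed.

    A bound on [E[Q | F_k]] is expressed as a bound on the integral of [Q] over every [A] in [F_k].
    The integrands are nonnegative, so these integrals make sense in the extended reals, and
    conditional expectations of [exp V_k] are never constructed. *)

Lemma ger0_is_derive_le (R : realType) (F dF : R -> R) (a b : R) : a <= b ->
  (forall x : R, is_derive x 1 F (dF x)) ->
  (forall x, a < x < b -> 0 <= dF x) -> F a <= F b.
Proof.
rewrite le_eqVlt => /predU1P[->//|ab] FdF dF_ge0.
have [|c] := MVT ab (fun x _ => FdF x).
  apply: derivable_within_continuous => x _.
  exact: (@ex_derive _ _ _ _ _ _ _ (FdF x)).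
rewrite in_itv/= => /dF_ge0 dFc FbFa.
by rewrite -subr_ge0 FbFa mulr_ge0// subr_ge0 ltW.
Qed.

Lemma expR_ge_quadratic (R : realType) (x : R) :
  0 <= x -> 1 + x + x ^+ 2 / 2 <= expR x.
Proof.
move=> x0; rewrite -subr_ge0.
pose F (y : R) := expR y - (1 + y + y ^+ 2 / 2).
have -> : 0 = F 0 by rewrite /F expR0; field.
apply: (@ger0_is_derive_le _ _ (fun y => expR y - (1 + y))) => // [y|y _].
  rewrite /F; apply: is_derive_eq; rewrite /GRing.scale/=; by field.
by rewrite /= subr_ge0 expR_ge1Dx.
Qed.

(** The function [(1 + y + y^2) exp(-y)] has derivative [y (1 - y) exp(-y)], so on []-oo, 1]] its
    minimum is the value 1 at 0. *)
Lemma expR_le_quadratic (R : realType) (x : R) :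
  x <= 1 -> expR x <= 1 + x + x ^+ 2.
Proof.
move=> x1.
pose F (y : R) := (1 + y + y ^+ 2) * expR (- y).
pose dF (y : R) := y * (1 - y) * expR (- y).
have FdF (y : R) : is_derive y 1 F (dF y).
  by rewrite /F /dF; apply: is_derive_eq; rewrite /GRing.scale/=; ring.
have : F 0 <= F x.
  have [x0|/ltW x0] := leP 0 x.
    apply: ger0_is_derive_le x0 FdF _ => y /andP[y0 yx].
    rewrite /dF !mulr_ge0 ?expR_ge0 ?subr_ge0 ?(ltW y0)// ltW//.
    exact: lt_le_trans yx x1.
  rewrite -lerN2.
  apply: (@ger0_is_derive_le _ (\- F) (\- dF)) x0 _ _ => y /andP[_ y0].
  rewrite /dF/= oppr_ge0 -mulrA mulr_le0_ge0 ?(ltW y0)// mulr_ge0 ?expR_ge0//.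
  by rewrite subr_ge0; lra.
rewrite /F oppr0 expR0 expRN => h.
rewrite -[leLHS]mul1r -ler_pdivlMr ?expR_gt0//.
by move: h; rewrite mulr1 !addr0 expr0n/= addr0.
Qed.

(** Valid on the whole line. The linear part vanishes in the mean of a centred variable and leaves
    an exponential moment of the square. *)
Lemma expR_le_add_sqr (R : realType) (x : R) : expR x <= x + expR (x ^+ 2).
Proof.
have [x1|/ltW x1] := leP x 1.
  apply: (le_trans (expR_le_quadratic x1)).
  by rewrite (addrC 1) -addrA lerD2l expR_ge1Dx.
apply: ler_wpDl; first by apply: le_trans x1.
by rewrite ler_expR; nra.
Qed.

Lemma expR_convex (R : realType) (p q x y : R) :
  0 <= p -> 0 <= q -> p + q = 1 ->
  expR (p * x + q * y) <= p * expR x + q * expR y.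
Proof.
move=> p0 q0 pq; set m := p * x + q * y.
have tangent (z : R) : expR m * (1 + (z - m)) <= expR z.
  have -> : expR z = expR m * expR (z - m) by rewrite -expRD addrC subrK.
  by rewrite ler_wpM2l ?expR_ge0// expR_ge1Dx.
apply: le_trans (lerD (ler_wpM2l p0 (tangent x)) (ler_wpM2l q0 (tangent y))).
have -> : p * (expR m * (1 + (x - m))) + q * (expR m * (1 + (y - m))) =
  expR m * (p + q + m - (p + q) * m) by rewrite /m; ring.
by rewrite pq mul1r addrK mulr1.
Qed.

(** The chord of [exp] between 0 and [t Y]. The right side is affine in [exp(t Y)] with coefficients
    depending on [u] and [t] only, so [u] may be random as long as [t] is fixed. *)
Lemma expR_chord (R : realType) (t u Y : R) : 0 < t -> 0 <= u <= t ->
  expR (u * Y) <= 1 - u / t + u / t * expR (t * Y).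
Proof.
move=> t0 /andP[u0 ut].
have tn0 : t != 0 by rewrite gt_eqF.
have -> : u * Y = (1 - u / t) * 0 + u / t * (t * Y) by field.
apply: le_trans (@expR_convex _ _ _ _ _ _ _ _) _.
- by rewrite subr_ge0 ler_pdivrMr// mul1r.
- by rewrite divr_ge0// ltW.
- by rewrite subrK.
- by rewrite expR0 mulr1.
Qed.

(* The three regimes of [u] that give [E exp(X) <= exp(2u)] for a centred [X]
   with [X^2 <= u Y]: the exponents [t = 1/4, 28/81, 7/32] of [exp(t Y)] are
   deterministic even when [u] is random. *)
Lemma expR_small (R : realType) (x u Y : R) :
  0 <= u <= 1 / 4 -> x ^+ 2 <= u * Y ->
  expR x <= x + ((1 - 4 * u) + 4 * u * expR (1 / 4 * Y)).
Proof.
move=> u01 xuY; apply: (le_trans (expR_le_add_sqr x)); rewrite lerD2l.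
apply: (le_trans (y := expR (u * Y))); first by rewrite ler_expR.
apply: le_trans (expR_chord _ _ u01) _ => //.
by have -> : u / (1 / 4) = 4 * u by field.
Qed.

Lemma expR_medium (R : realType) (x u Y : R) :
  0 <= u <= 28 / 81 -> x ^+ 2 <= u * Y ->
  expR x <= x + ((1 - 81 / 28 * u) + 81 / 28 * u * expR (28 / 81 * Y)).
Proof.
move=> u01 xuY; apply: (le_trans (expR_le_add_sqr x)); rewrite lerD2l.
apply: (le_trans (y := expR (u * Y))); first by rewrite ler_expR.
apply: le_trans (expR_chord _ _ u01) _ => //.
by have -> : u / (28 / 81) = 81 / 28 * u by field.
Qed.

(** Since [4 * 8/7 * 7/32 = 1], the arithmetic-geometric inequality puts [sqrt(u Y)] below
    [8/7 u + 7/32 Y]. No linear term is kept: for large [u] the distance from [8/7 u] to [2 u] pays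
    for the tail constant. *)
Lemma expR_large (R : realType) (x u Y : R) :
  0 <= u -> 0 <= Y -> x ^+ 2 <= u * Y ->
  expR x <= expR (8 / 7 * u) * expR (7 / 32 * Y).
Proof.
move=> u0 Y0 xuY; rewrite -expRD ler_expR.
have s0 : 0 <= 8 / 7 * u + 7 / 32 * Y by nra.
have [x0|x0] := leP x 0; first by apply: le_trans s0.
rewrite -(@ler_pXn2r _ 2)// ?nnegrE ?(ltW x0)//; apply: (le_trans xuY).
have -> : (8 / 7 * u + 7 / 32 * Y) ^+ 2 =
  u * Y + (8 / 7 * u - 7 / 32 * Y) ^+ 2 by field.
by rewrite lerDl sqr_ge0.
Qed.

(** The tail constant at [t = 1/4] is [sqrt 2 <= 3/2], and [1 + 4u (3/2 - 1) = 1 + 2u] is the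
    tangent of [exp(2u)] at 0. *)
Lemma small_budget (R : realType) (u c : R) : 0 <= u <= 1 / 4 -> c <= 3 / 2 ->
  expR (- (2 * u)) * (1 - 4 * u) + expR (- (2 * u)) * (4 * u) * c <= 1.
Proof.
move=> /andP[u0 u1] c0.
rewrite -mulrA -mulrDr expRN mulrC ler_pdivrMr ?expR_gt0// mul1r.
have := expR_ge1Dx (2 * u); nra.
Qed.

(** At [t = 28/81] the tail constant [1 / sqrt(1 - 2t)] is exactly 9/5. The slope
    [81/28 * 4/5 = 81/35] exceeds 2, so the tangent no longer suffices, but for [u >= 1/4] the
    quadratic term of [exp(2u)] makes up the difference. *)
Lemma medium_budget (R : realType) (u c : R) :
  1 / 4 <= u <= 28 / 81 -> c <= 9 / 5 ->
  expR (- (2 * u)) * (1 - 81 / 28 * u) +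
  expR (- (2 * u)) * (81 / 28 * u) * c <= 1.
Proof.
move=> /andP[u0 u1] c0.
rewrite -[X in _ + X]mulrA -mulrDr expRN mulrC ler_pdivrMr ?expR_gt0// mul1r.
have := @expR_ge_quadratic _ (2 * u); nra.
Qed.

(** At [t = 7/32] the tail constant is exactly 4/3. The left end [u = 28/81] gives the exponent
    [6/7 u = 8/27], whose quadratic lower bound 977/729 just exceeds 4/3. *)
Lemma large_budget (R : realType) (u c : R) : 28 / 81 <= u -> c <= 4 / 3 ->
  expR (- (2 * u)) * expR (8 / 7 * u) * c <= 1.
Proof.
move=> u0 c0; rewrite -expRD.
have -> : - (2 * u) + 8 / 7 * u = - (6 / 7 * u) by field.
rewrite expRN mulrC ler_pdivrMr ?expR_gt0// mul1r.
have := @expR_ge_quadratic _ (6 / 7 * u); nra.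
Qed.

(** Squaring turns the claim into [exp(-12 s) <= 1 - 6 s]. The left side is convex in [s] and the
    right side is the line through the points (0, 1) and (1/8, 1/4), so only [exp(3/2) >= 4] has to
    be checked. *)
Lemma chi_square_le (R : realType) (s : R) : 0 < s <= 1 / 8 ->
  expR (- (6 * s)) * (1 / Num.sqrt (1 - 2 * (3 * s))) <= 1.
Proof.
move=> /andP[s0 s1].
have d0 : 0 < 1 - 2 * (3 * s) by lra.
rewrite div1r ler_pdivrMr ?sqrtr_gt0// mul1r.
rewrite -[leLHS]ger0_norm ?expR_ge0// -sqrtr_sqr ler_sqrt; last exact: ltW.
rewrite -expRM_natr.
have -> : - (6 * s) * 2 = 8 * s * (- (3 / 2)) by field.
have -> : 8 * s * (- (3 / 2)) =
  (1 - 8 * s) * 0 + 8 * s * (- (3 / 2)) :> R by ring.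
apply: le_trans (@expR_convex _ _ _ _ _ _ _ _) _; try lra.
rewrite expR0 expRN.
have e32 : 4 <= expR (3 / 2 : R).
  (* [exp(1/2) >= 1 + 1/2 + 1/8 = 13/8], and the cube of 13/8 exceeds 4. *)
  have -> : (3 / 2 : R) = 1 / 2 * 3 by field.
  rewrite expRM_natr.
  have h := @expR_ge_quadratic R (1 / 2).
  have {}h : 13 / 8 <= expR (1 / 2 : R) by apply: le_trans (h _); lra.
  by apply: le_trans (lerXn2r 3 _ _ h); rewrite ?nnegrE; lra.
have : (expR (3 / 2 : R))^-1 <= 4^-1.
  by rewrite lef_pV2 ?posrE ?expR_gt0//; lra.
by nra.
Qed.

(** Serves in place of Hölder's inequality with exponents 3/2 and 3: both exponentials will be
    normalised to mean at most 1, so a convex combination is enough. *)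
Lemma expR_young (R : realType) (x y p q : R) :
  expR (x + y - p - q) <=
  2 / 3 * expR (3 / 2 * x - 3 / 2 * p) + 1 / 3 * expR (3 * y - 3 * q).
Proof.
have -> : x + y - p - q =
  2 / 3 * (3 / 2 * x - 3 / 2 * p) + 1 / 3 * (3 * y - 3 * q) by field.
by apply: expR_convex; lra.
Qed.

(** * Partial sums of the inverse squares *)

Lemma sin_le_id (R : realType) (x : R) : 0 <= x -> sin x <= x.
Proof.
move=> x0; rewrite -subr_ge0.
have -> : 0 = 0 - sin 0 :> R by rewrite sin0 subrr.
by apply: (@ger0_is_derive_le _ (fun y => y - sin y) (fun y => 1 - cos y)) =>
  // y _; rewrite subr_ge0 cos_le1.
Qed.

(** The double angle formula, with [cos (x / 2)] written as a sine so that the identity applies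
    again to each of its two terms. *)
Lemma csc2_half (R : realType) (x : R) : 0 < x < pi ->
  (sin x ^+ 2)^-1 =
  4^-1 * ((sin (x / 2) ^+ 2)^-1 + (sin ((pi - x) / 2) ^+ 2)^-1).
Proof.
move=> /andP[x0 xpi].
have -> : sin ((pi - x) / 2) = cos (x / 2).
  by rewrite mulrBl sinB sin_pihalf cos_pihalf mul0r subr0 mul1r.
have sx0 : sin (x / 2) != 0 by rewrite gt_eqF// sin_gt0_pi//; lra.
have cx0 : cos (x / 2) != 0 by rewrite gt_eqF// cos_gt0_pihalf//; lra.
have -> : sin x = 2 * (cos (x / 2) * sin (x / 2)).
  by rewrite mulr_natl -sin_mulr2n; congr sin; rewrite mulr2n; field.
have cs := cos2Dsin2 (x / 2).
rewrite -[LHS]mul1r -[X in X * _]cs.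
by field; rewrite cx0 sx0.
Qed.

(* Repeated angle halving from [1 / sin(pi/4)^2 = 2]; with [sin x <= x] this
   yields the bound pi^2 / 8 for the odd inverse squares. *)
Lemma csc2_sum (R : realType) (n : nat) :
  \sum_(0 <= k < 2 ^ n)
    (sin ((2 * k + 1)%:R * pi / 2 ^+ n.+2 : R) ^+ 2)^-1 = 2 * 4 ^+ n.
Proof.
elim: n => [|n IHn].
  rewrite expn0 big_nat1 expr0 mulr1.
  have h := @csc2_half R (pi / 2).
  have pi0 := @pi_gt0 R.
  have {}h : (sin (pi / 2) ^+ 2)^-1 = _ := h ltac:(lra).
  rewrite sin_pihalf expr1n invr1 in h.
  have e1 : (pi - pi / 2) / 2 = pi / 2 / 2 :> R by field.
  rewrite e1 in h.
  have -> : (2 * 0 + 1)%:R * pi / 2 ^+ 2 = pi / 2 / 2 :> R.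
    by rewrite muln0 add0n mul1r; field.
  by lra.
rewrite (@big_cat_nat _ _ _ (2 ^ n))//=; last by rewrite leq_exp2l.
rewrite -{2}(add0n (2 ^ n)%N) big_addn.
have e2 : (2 ^ n.+1 - 2 ^ n = 2 ^ n)%N by rewrite expnS mul2n -addnn addnK.
(* Reversing the upper half pairs [k] with [2^(n+1) - 1 - k]. If [x] is the angle of [k] at level
   [n], the two angles of the pair are [x / 2] and [(pi - x) / 2]. *)
rewrite e2 [X in _ + X]big_nat_rev/= -big_split/=.
have -> : 2 * 4 ^+ n.+1 = 4 * (2 * 4 ^+ n) :> R by rewrite exprS; ring.
rewrite -IHn mulr_sumr; apply: eq_big_nat => k /andP[_ kn].
have pn0 : (0 : R) < 2 ^+ n.+2 by rewrite exprn_gt0.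
have E1 : (2 * k + 1)%:R * pi / 2 ^+ n.+3 =
   (2 * k + 1)%:R * pi / 2 ^+ n.+2 / 2 :> R.
  by rewrite [2 ^+ n.+3]exprS; field; rewrite lt0r_neq0.
have E2 : (2 * (0 + 2 ^ n - k.+1 + 2 ^ n) + 1)%:R * pi / 2 ^+ n.+3 =
   (pi - (2 * k + 1)%:R * pi / 2 ^+ n.+2) / 2 :> R.
  have -> : (2 * (0 + 2 ^ n - k.+1 + 2 ^ n) + 1 = 2 ^ n.+2 - (2 * k + 1))%N.
    rewrite !expnS; lia.
  rewrite natrB; last by rewrite !expnS; lia.
  by rewrite [2 ^+ n.+3]exprS natrX; field; rewrite lt0r_neq0.
rewrite E1 E2 [in RHS]csc2_half; first by rewrite mulrA mulfV// mul1r.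
apply/andP; split; first by rewrite divr_gt0// mulr_gt0 ?pi_gt0 ?ltr0n ?addn1.
rewrite ltr_pdivrMr// mulrC ltr_pM2l ?pi_gt0// -natrX ltr_nat.
by rewrite !expnS; lia.
Qed.

Lemma odd_basel_le (R : realType) (N : nat) :
  \sum_(0 <= k < N) (((2 * k + 1)%:R ^+ 2)^-1 : R) <= pi ^+ 2 / 8.
Proof.
(* Nonnegative terms are added to reach a power of two, the lengths that [csc2_sum] evaluates. *)
apply: (@le_trans _ _ (\sum_(0 <= k < 2 ^ N) (((2 * k + 1)%:R ^+ 2)^-1 : R))).
  rewrite (@big_cat_nat _ _ _ N _ (2 ^ N))//=; last by rewrite ltnW// ltn_expl.
  by rewrite lerDl sumr_ge0// => k _; rewrite invr_ge0 sqr_ge0.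
have pi0 := @pi_gt0 R.
have pn0 : (0 : R) < 2 ^+ N.+2 by rewrite exprn_gt0.
have c0 : 0 < (2 ^+ N.+2 / pi) ^+ 2 :> R by rewrite exprn_gt0// divr_gt0.
rewrite -(ler_pM2l c0) mulr_sumr.
have -> : (2 ^+ N.+2 / pi) ^+ 2 * (pi ^+ 2 / 8) = 2 * 4 ^+ N :> R.
  have -> : 2 ^+ N.+2 = 4 * 2 ^+ N :> R by rewrite 2!exprS; ring.
  have -> : 4 ^+ N = (2 ^+ N) ^+ 2 :> R.
    by rewrite -exprM mulnC exprM; congr (_ ^+ N); ring.
  by move: pi pi0 => p p0; field; rewrite gt_eqF.
rewrite -csc2_sum ler_sum_nat// => k /andP[_ kn].
have x0 : (0 : R) < (2 * k + 1)%:R * pi / 2 ^+ N.+2.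
  by rewrite divr_gt0// mulr_gt0// ltr0n addn1.
have -> : (2 ^+ N.+2 / pi) ^+ 2 * ((2 * k + 1)%:R ^+ 2)^-1 =
   (((2 * k + 1)%:R * pi / 2 ^+ N.+2) ^+ 2)^-1 :> R.
  by rewrite !exprMn !exprVn !invfM !invrK; ring.
have xpi : (2 * k + 1)%:R * pi / 2 ^+ N.+2 < pi :> R.
  rewrite ltr_pdivrMr// mulrC ltr_pM2l// -natrX ltr_nat.
  by rewrite !expnS; lia.
rewrite lef_pV2 ?posrE ?exprn_gt0// ?sin_gt0_pi ?x0//.
rewrite ler_pXn2r ?nnegrE ?(ltW x0)//.
  exact: sin_le_id (ltW x0).
by rewrite ltW// sin_gt0_pi// x0.
Qed.

(** The even denominators up to [2N] contribute a quarter of the sum up to [N], and the sum grows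
    with its length, so three quarters of it are at most the odd part. No limit is taken. *)
Lemma basel_le (R : realType) (N : nat) :
  \sum_(0 <= k < N) ((k.+1%:R ^+ 2)^-1 : R) <= pi ^+ 2 / 6.
Proof.
pose S n : R := \sum_(0 <= k < n) (k.+1%:R ^+ 2)^-1.
have SE : S (2 * N)%N =
    \sum_(0 <= k < N) (((2 * k + 1)%:R ^+ 2)^-1) + 4^-1 * S N.
  rewrite /S; elim: N => [|n IHn]; first by rewrite muln0 !big_nil mulr0 addr0.
  rewrite mulnS add2n !big_nat_recr//= IHn addn1.
  have -> : ((2 * n).+2%:R : R) = 2 * n.+1%:R.
    by rewrite -natrM; congr (_%:R); lia.
  have -> : (2 * n.+1%:R) ^- 2 = 4^-1 * n.+1%:R ^- 2 :> R.
    by rewrite exprMn invfM; congr (_^-1 * _); ring.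
  by ring.
have SN : S N <= S (2 * N)%N.
  rewrite /S [leRHS](@big_cat_nat _ _ _ N)//=; last by lia.
  by rewrite lerDl sumr_ge0// => k _; rewrite invr_ge0 sqr_ge0.
have := @odd_basel_le R N; rewrite -/(S N); move: SN; rewrite SE; lra.
Qed.

(** * Smooth and strongly convex functions *)

Definition dot (R : realType) (d : nat) (u v : 'rV[R]_d) : R :=
  \sum_(i < d) u 0 i * v 0 i.

Lemma dotC (R : realType) (d : nat) (u v : 'rV[R]_d) : dot u v = dot v u.
Proof. by apply: eq_bigr => i _; rewrite mulrC. Qed.

Lemma dotDl (R : realType) (d : nat) (u v w : 'rV[R]_d) :
  dot (u + v) w = dot u w + dot v w.
Proof. by rewrite -big_split; apply: eq_bigr => i _; rewrite mxE mulrDl. Qed.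

Lemma dotDr (R : realType) (d : nat) (u v w : 'rV[R]_d) :
  dot w (u + v) = dot w u + dot w v.
Proof. by rewrite dotC dotDl !(dotC w). Qed.

Lemma dotZl (R : realType) (d : nat) (a : R) (u v : 'rV[R]_d) :
  dot (a *: u) v = a * dot u v.
Proof. by rewrite mulr_sumr; apply: eq_bigr => i _; rewrite mxE mulrA. Qed.

Lemma dotZr (R : realType) (d : nat) (a : R) (u v : 'rV[R]_d) :
  dot u (a *: v) = a * dot u v.
Proof. by rewrite dotC dotZl dotC. Qed.

Lemma dotBl (R : realType) (d : nat) (u v w : 'rV[R]_d) :
  dot (u - v) w = dot u w - dot v w.
Proof. by rewrite dotDl -scaleN1r dotZl mulN1r. Qed.

Lemma enorm_ge0 (R : realType) (d : nat) (v : 'rV[R]_d) : 0 <= enorm v.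
Proof. exact: sqrtr_ge0. Qed.

Lemma sqr_enorm (R : realType) (d : nat) (v : 'rV[R]_d) :
  enorm v ^+ 2 = dot v v.
Proof.
rewrite sqr_sqrtr; first by apply: eq_bigr => i _; rewrite expr2.
by apply: sumr_ge0 => i _; exact: sqr_ge0.
Qed.

Lemma dotvv_ge0 (R : realType) (d : nat) (v : 'rV[R]_d) : 0 <= dot v v.
Proof. by rewrite -sqr_enorm sqr_ge0. Qed.

Lemma enormZ (R : realType) (d : nat) (a : R) (v : 'rV[R]_d) :
  enorm (a *: v) = `|a| * enorm v.
Proof.
apply/eqP; rewrite -(@eqrXn2 _ 2)// ?mulr_ge0// ?enorm_ge0//.
by rewrite exprMn real_normK ?num_real// !sqr_enorm dotZl dotZr mulrA expr2.
Qed.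

(** Lagrange's identity: the double sum of squares is twice the defect of the inequality. *)
Lemma cauchy_schwarz_sqr (R : realType) (d : nat) (u v : 'rV[R]_d) :
  dot u v ^+ 2 <= dot u u * dot v v.
Proof.
have : 0 <= \sum_(i < d) \sum_(j < d) (u 0 i * v 0 j - u 0 j * v 0 i) ^+ 2.
  by apply: sumr_ge0 => i _; apply: sumr_ge0 => j _; exact: sqr_ge0.
have -> : \sum_(i < d) \sum_(j < d) (u 0 i * v 0 j - u 0 j * v 0 i) ^+ 2 =
    dot u u * dot v v + dot v v * dot u u - 2 * (dot u v * dot u v).
  rewrite /dot !big_distrlr/= mulr_sumr -sumrN -!big_split/=.
  apply: eq_bigr => i _; rewrite mulr_sumr -sumrN -!big_split/=.
  by apply: eq_bigr => j _; ring.
by rewrite expr2; lra.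
Qed.

Lemma cauchy_schwarz (R : realType) (d : nat) (u v : 'rV[R]_d) :
  `|dot u v| <= enorm u * enorm v.
Proof.
rewrite -(@ler_pXn2r _ 2)// ?nnegrE ?mulr_ge0 ?enorm_ge0//.
by rewrite real_normK ?num_real// exprMn !sqr_enorm cauchy_schwarz_sqr.
Qed.

Lemma derive_grad (R : realType) (d : nat) (f : 'rV[R]_d -> R)
    (x v : 'rV[R]_d) :
  differentiable f x -> 'D_v f x = dot (grad f x) v.
Proof.
move=> df; rewrite deriveE// [in LHS](row_sum_delta v) linear_sum.
apply: eq_bigr => i _.
by rewrite linearZ/= mxE deriveE// mulrC.
Qed.

Lemma is_derive_line (R : realType) (d : nat) (f : 'rV[R]_d -> R)
    (x v : 'rV[R]_d) (t : R) : differentiable f (x + t *: v) ->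
  is_derive t 1 (fun s : R => f (x + s *: v)) (dot (grad f (x + t *: v)) v).
Proof.
move=> df.
have E : (fun h : R => h^-1 *: (((fun s : R => f (x + s *: v)) \o shift t)
      (h *: (1 : R)) - f (x + t *: v))) =
    (fun h => h^-1 *: ((f \o shift (x + t *: v)) (h *: v) - f (x + t *: v))).
  apply/funext => h /=; congr (_ *: (f _ - _)).
  by rewrite /shift/= [h *: 1]mulr1 scalerDl addrCA.
apply: DeriveDef.
  by rewrite /derivable E; exact: diff_derivable.
by rewrite -derive_grad// /derive E.
Qed.

Lemma is_derive_quadratic_correction (R : realType) (h : R -> R)
    (a sg C D t : R) :
  is_derive t 1 h D ->
  is_derive t 1 (fun s => a * s ^+ 2 - sg * (h s - s * C))
    (2 * a * t - sg * (D - C)).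
Proof.
move=> hD; apply: is_derive_eq.
by rewrite /GRing.scale/=; field.
Qed.

(** [F] is nondecreasing on [[0, 1]]: Cauchy-Schwarz and the Lipschitz gradient make its derivative
    nonnegative. The sign gives two bounds at once, the descent lemma for [sg = 1] and its lower
    counterpart for [sg = -1]. *)
Lemma smooth_bound (R : realType) (d : nat) (L : R) (f : 'rV[R]_d -> R)
    (x v : 'rV[R]_d) (sg : R) : smooth L f -> `|sg| <= 1 ->
  sg * (f (x + v) - f x - dot (grad f x) v) <= L / 2 * enorm v ^+ 2.
Proof.
move=> [df lipf] sg1.
pose F (t : R) := L / 2 * enorm v ^+ 2 * t ^+ 2 -
  sg * (f (x + t *: v) - t * dot (grad f x) v).
pose dF (t : R) := 2 * (L / 2 * enorm v ^+ 2) * t -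
  sg * (dot (grad f (x + t *: v)) v - dot (grad f x) v).
have FdF (t : R) : is_derive t 1 F (dF t).
  exact/is_derive_quadratic_correction/is_derive_line.
have dF_ge0 (t : R) : 0 < t < 1 -> 0 <= dF t.
  move=> /andP[t0 _].
  rewrite subr_ge0 -dotBl; apply: (le_trans (ler_norm _)).
  rewrite normrM; apply: (le_trans (ler_wpM2r _ sg1)) => //; rewrite mul1r.
  apply: (le_trans (cauchy_schwarz _ _)).
  have -> : 2 * (L / 2 * enorm v ^+ 2) * t = L * t * enorm v * enorm v by field.
  rewrite ler_wpM2r ?enorm_ge0//.
  apply: (le_trans (lipf _ _)).
  by rewrite (addrC x) addrK enormZ gtr0_norm// mulrA.
have := ger0_is_derive_le ler01 FdF dF_ge0.
by rewrite /F scale0r scale1r addr0 expr0n expr1n/=; lra.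
Qed.

Lemma smooth_descent (R : realType) (d : nat) (L : R) (f : 'rV[R]_d -> R)
    (x v : 'rV[R]_d) : smooth L f ->
  f (x + v) <= f x + dot (grad f x) v + L / 2 * enorm v ^+ 2.
Proof.
move=> sf; have := @smooth_bound _ _ _ _ x v 1 sf.
by rewrite normr1 lexx mul1r => /(_ isT); lra.
Qed.

(** The chord inequality at [x + a *: v] is compared with the lower smoothness bound there; division
    by [a] leaves an error of order [a], which can be made arbitrarily small. *)
Lemma strongly_convex_grad (R : realType) (d : nat) (mu L : R)
    (f : 'rV[R]_d -> R) (x y : 'rV[R]_d) :
  strongly_convex mu f -> smooth L f ->
  f x + dot (grad f x) (y - x) + mu / 2 * enorm (y - x) ^+ 2 <= f y.
Proof.
move=> scf sf; set v := y - x.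
have H (a : R) : 0 < a < 1 -> dot (grad f x) v <=
    f y - f x - mu / 2 * enorm v ^+ 2 + a * ((mu / 2 + L / 2) * enorm v ^+ 2).
  move=> /andP[a0 a1].
  have := scf y x a; rewrite -/v => /(_ ltac:(lra)).
  have -> : a *: y + (1 - a) *: x = x + a *: v.
    by rewrite /v scalerBl scale1r scalerBr addrCA addrA.
  have := @smooth_bound _ _ _ _ x (a *: v) (-1) sf.
  rewrite normrN normr1 lexx => /(_ isT).
  rewrite dotZr enormZ gtr0_norm// exprMn => h1 h2.
  rewrite -(ler_pM2l a0); nra.
set c := (mu / 2 + L / 2) * enorm v ^+ 2 in H.
have c1 : 0 < `|c| + 1 by rewrite ltr_wpDl.
suff : dot (grad f x) v <= f y - f x - mu / 2 * enorm v ^+ 2 by lra.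
apply/ler_addgt0Pr => e e0.
pose a := Num.min (1 / 2) (e / (`|c| + 1)).
have a0 : 0 < a by rewrite lt_min !divr_gt0.
have a1 : a < 1 by rewrite gt_min; apply/orP; left; lra.
apply: (le_trans (H a _)); first by rewrite a0.
rewrite lerD2l.
have ae : a <= e / (`|c| + 1) by rewrite ge_min lexx orbT.
rewrite ler_pdivlMr// in ae.
apply: le_trans ae; rewrite ler_pM2l//.
by rewrite (le_trans (ler_norm c))// lerDl.
Qed.

(** Strong convexity bounds the value at a minimiser [y] below by a quadratic in [v = y - x].
    Completing the square, [|G + mu v|^2 >= 0], gives the least value of that quadratic. *)
Lemma polyak_lojasiewicz (R : realType) (d : nat) (mu L fstar : R)
    (f : 'rV[R]_d -> R) (x : 'rV[R]_d) : 0 < mu ->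
  strongly_convex mu f -> smooth L f -> is_minimum f fstar ->
  2 * mu * (f x - fstar) <= dot (grad f x) (grad f x).
Proof.
move=> mu0 scf sf [[y fy] _].
have := strongly_convex_grad x y scf sf; rewrite fy.
set v := y - x; set G := grad f x => h.
have := dotvv_ge0 (G + mu *: v).
rewrite sqr_enorm in h.
rewrite dotDl !dotDr !dotZl !dotZr (dotC v G) => h2; nra.
Qed.

(** With [t = mu (kappa + 1) / 16] one has [t eta = 1/4], so for [c = L eta] the descent lemma
    yields [-(1/4 - c/8) |grad f|^2]. Of this, 1/16 contracts the gap through the Polyak-Lojasiewicz
    inequality, [3 (1 - c)^2 / 16] is the reserve [3 |a|^2] against the noise, and the remainder
    [c (4 - 3c) / 16] is nonnegative as [c <= 1]. The vector [a] collects all terms linear in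
    [z]. *)
Lemma sgd_step (R : realType) (d : nat) (mu L fstar : R)
    (f : 'rV[R]_d -> R) (x g z a : 'rV[R]_d) (eta kappa : R) :
  0 < mu -> 0 < L ->
  strongly_convex mu f -> smooth L f -> is_minimum f fstar ->
  0 < kappa -> eta = 4 / (mu * (kappa + 1)) -> L * eta <= 1 ->
  z = g - grad f x -> a = - ((1 - L * eta) / 4) *: grad f x ->
  mu * (kappa + 1) / 16 * (f (x - eta *: g) - fstar) <=
  mu * (kappa - 1) / 16 * (f x - fstar) +
  (dot a z + L * eta / 8 * enorm z ^+ 2 - 3 * dot a a).
Proof.
move=> mu0 L0 scf sf fmin kappa0 etaE c1 zE ->.
have PL := polyak_lojasiewicz x mu0 scf sf fmin.
have := @smooth_descent _ _ _ _ x (- eta *: g) sf.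
have -> : g = grad f x + z by rewrite zE addrC subrK.
rewrite !sqr_enorm -scaleNr !dotZl !dotZr !(dotDl, dotDr) (dotC z).
move: PL; set G := dot _ (grad f x); set D := dot _ z; set Y := dot z z.
set S := f (x + _); set D0 := f x - fstar => PL descent.
have eta0 : 0 < eta by rewrite etaE divr_gt0// mulr_gt0//; lra.
have tE : mu * (kappa + 1) / 16 * eta = 1 / 4.
  by rewrite etaE; field; rewrite gt_eqF//=; lra.
have t0 : 0 < mu * (kappa + 1) / 16 by rewrite divr_gt0// mulr_gt0//; lra.
set t := mu * (kappa + 1) / 16 in tE t0 *.
have -> : mu * (kappa - 1) / 16 = t - mu / 8 by rewrite /t; field.
have c0 : 0 < L * eta by rewrite mulr_gt0.
have {descent} := ler_wpM2l (ltW t0) descent.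
rewrite [X in _ <= X](_ : _ = t * f x - (t * eta) * (G + D) +
  (t * eta) * (L * eta) / 2 * (G + D + (D + Y))); last by field.
rewrite tE; set c := L * eta in c0 c1 *.
have : 0 <= G * (c * (4 - 3 * c)).
  by rewrite mulr_ge0 ?dotvv_ge0// mulr_ge0//; lra.
by move: PL; rewrite /D0; move: (f x) S => F S; nra.
Qed.

(** * Measurability with respect to a sub-sigma-algebra *)

(** Measurable coordinates suffice, because an open set is a countable union of boxes with rational
    centres and radii [1 / (n + 1)]. *)
Lemma measurable_preimage_open (R : realType) (d : nat) (dT : measure_display)
    (T : measurableType dT) (X : T -> 'rV[R]_d) (U : set 'rV[R]_d) :
  (forall i, measurable_fun setT (fun w => X w 0 i)) -> open U ->
  measurable (X @^-1` U).
Proof.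
move=> mX oU.
pose box (qn : 'rV[rat]_d * nat) : set 'rV[R]_d :=
  [set y | forall i, `|ratr (qn.1 0 i) - y 0 i| < qn.2.+1%:R^-1].
(* Boxes not contained in [U] contribute the empty set, so the union runs over a whole countable
   type. *)
pose C (qn : 'rV[rat]_d * nat) : set T :=
  if pselect (box qn `<=` U) is left _ then X @^-1` box qn else set0.
have -> : X @^-1` U = \bigcup_qn C qn.
  apply/seteqP; split => [w Uw|w [qn _]]; last first.
    by rewrite /C; case: pselect => // sub; exact: sub.
  have [e e0 eU] : exists2 e : R, 0 < e & ball (X w) e `<=` U.
    by apply/nbhs_ballP; exact: open_nbhs_nbhs.
  have [n _ /(_ n (leqnn n)) ne] := near_infty_natSinv_lt
    (PosNum (divr_gt0 e0 (ltr0Sn R 1))).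
  have n0 : (0 : R) < n.+1%:R^-1 by rewrite invr_gt0.
  have /choice[q qP] (i : 'I_d) : exists q : rat,
      `|ratr q - X w 0 i| < n.+1%:R^-1.
    have lt_e : X w 0 i < X w 0 i + n.+1%:R^-1 by rewrite ltrDl.
    have [q] := rat_in_itvoo lt_e.
    rewrite in_itv/= => /andP[h1 h2]; exists q.
    by rewrite ger0_norm ?subr_ge0 ?ltW// ltrBlDl.
  exists (\row_i q i, n) => //; rewrite /C.
  case: pselect => [_ i|]; first by rewrite mxE.
  case=> y boxy; apply: eU; split=> // i j; rewrite ord1.
  have := boxy j; rewrite /= mxE => h1; have h2 := qP j.
  rewrite /ball/= (le_lt_trans (ler_distD (ratr (q j)) _ _))//.
  by rewrite [e]splitr ltrD// ?(lt_trans h1)// distrC (lt_trans h2).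
apply: countable_bigcupT_measurable => // qn.
rewrite /C; case: pselect => // _.
have -> : X @^-1` box qn =
    \bigcap_(i in [set: 'I_d])
      [set w | `|ratr (qn.1 0 i) - X w 0 i| < qn.2.+1%:R^-1].
  by apply/seteqP; split => w h i; [move=> _; exact: h|exact: h].
apply: fin_bigcap_measurable => // i _.
have mD : measurable_fun setT (fun w => `|ratr (qn.1 0 i) - X w 0 i|).
  by apply: measurableT_comp => //; exact: measurable_funB.
have := mD measurableT _ (measurable_itv `]-oo, qn.2.+1%:R^-1[).
by rewrite setTI; congr measurable.
Qed.

Lemma measurable_continuous_comp (R : realType) (d : nat) (dT : measure_display)
    (T : measurableType dT) (X : T -> 'rV[R]_d) (f : 'rV[R]_d -> R) :
  (forall i, measurable_fun setT (fun w => X w 0 i)) -> continuous f ->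
  measurable_fun setT (f \o X).
Proof.
move=> mX cf; apply: (measurability _ (RGenOpens.measurableE R)).
move=> _ [_ [a [b ->] <-]]; rewrite setTI comp_preimage.
apply: measurable_preimage_open => //.
by move/continuousP : cf; apply; exact: interval_open.
Qed.

(** The sub-sigma-algebra becomes the canonical one of a type, so that the general measurability
    lemmas apply to functions known at time [k]. *)
Notation measurable_in G Z :=
  (measurable_fun (setT : set (g_sigma_algebraType G)) Z) (only parsing).

Lemma measurable_wrtP (R : realType) (dO : measure_display)
    (Omega : measurableType dO) (G : set (set Omega)) (Z : Omega -> R) :
  measurable_wrt <<s G >> Z <->
  measurable_in G Z.
Proof.
split=> [h _ B mB|h _ [B mB <-]]; last exact: h.
by apply: h; exists B.
Qed.

Lemma sub_measurable_fun (dO dT : measure_display) (Omega : measurableType dO)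
    (T : measurableType dT) (G : set (set Omega)) (Z : Omega -> T) :
  <<s G >> `<=` measurable ->
  measurable_in G Z -> measurable_fun setT Z.
Proof. by move=> sG mZ _ B mB; apply: sG; exact: mZ. Qed.

Lemma g_sigma_measurable_funS (dO dT : measure_display)
    (Omega : measurableType dO) (T : measurableType dT)
    (G H : set (set Omega)) (Z : Omega -> T) :
  <<s G >> `<=` <<s H >> ->
  measurable_in G Z ->
  measurable_in H Z.
Proof. by move=> sG mZ _ B mB; apply: sG; exact: mZ. Qed.

(** * Conditional inequalities *)

Section weight.
Import HBNNSimple.

(** The hypothesis on sets extends by linearity to simple weights and by monotone convergence to
    [W]. Both integrals may be infinite, so unbounded weights such as [exp V_k] are allowed. *)
Lemma integral_weight_le (R : realType) (dO : measure_display)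
    (Omega : measurableType dO) (P : {measure set Omega -> \bar R})
    (G : set (set Omega)) (Y1 Y2 W : Omega -> R) :
  <<s G >> `<=` measurable ->
  measurable_fun setT Y1 -> measurable_fun setT Y2 ->
  (forall w, 0 <= Y1 w) -> (forall w, 0 <= Y2 w) ->
  (forall A, <<s G >> A ->
    (\int[P]_(w in A) (Y1 w)%:E <= \int[P]_(w in A) (Y2 w)%:E)%E) ->
  measurable_in G W ->
  (forall w, 0 <= W w) ->
  (\int[P]_w (W w * Y1 w)%:E <= \int[P]_w (W w * Y2 w)%:E)%E.
Proof.
move=> sG mY1 mY2 Y10 Y20 Y12 mW W0.
have mWE : measurable_in G (EFin \o W).
  exact/measurable_EFinP.
pose h := nnsfun_approx (@measurableT _ (g_sigma_algebraType G)) mWE.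
(* The same simple functions, seen on [Omega] with its full sigma-algebra, where [P] lives; their
   level sets still lie in [<<s G >>]. *)
pose h' n : Omega -> R := h n.
have mh n : measurable_fun setT (h' n).
  by apply: (sub_measurable_fun sG); exact: measurable_funP.
have h0 n w : 0 <= h' n w by exact: (@fun_ge0 _ _ (h n)).
have ndh w : {homo h'^~ w : n m / (n <= m)%N >-> n <= m}.
  move=> n m nm; have /lefP :=
    nd_nnsfun_approx (@measurableT _ (g_sigma_algebraType G)) mWE nm.
  exact.
have approx (Y : Omega -> R) : measurable_fun setT Y -> (forall w, 0 <= Y w) ->
    (\int[P]_w (h' n w * Y w)%:E)%E @[n --> \oo] -->
    (\int[P]_w (W w * Y w)%:E)%E.
  move=> mY Y0.
  have WE w : (W w * Y w)%:E = limn (fun n => (h' n w * Y w)%:E).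
    apply/esym/cvg_lim => //.
    apply: cvg_EFin; first by near=> n.
    apply: cvgMr_tmp => //.
    have := cvg_nnsfun_approx (@measurableT _ (g_sigma_algebraType G)) mWE
      (fun w _ => W0 w) (I : setT w).
    exact: fine_cvg.
  under [X in _ --> X]eq_integral do rewrite WE.
  apply: cvg_monotone_convergence => //.
  - by move=> n; apply/measurable_EFinP/measurable_funM.
  - by move=> n w _; rewrite lee_fin mulr_ge0.
  - by move=> w _ n m nm; rewrite lee_fin ler_wpM2r// ndh.
have mA n y : <<s G >> (h' n @^-1` [set y]).
  by have := @measurable_sfunP _ _ (g_sigma_algebraType G) _ (h n) [set y]
    (measurable_set1 y).
have finh n : finite_set (range (h n)) by exact: fimfunP.
have integral_h (Y : Omega -> R) n :
    measurable_fun setT Y -> (forall w, 0 <= Y w) ->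
    (\int[P]_w (h' n w * Y w)%:E = \sum_(y \in range (h n))
      (y%:E * \int[P]_(w in h' n @^-1` [set y]) (Y w)%:E))%E.
  move=> mY Y0.
  transitivity (\int[P]_w (\sum_(y \in range (h n))
      (y * (Y w * \1_(h' n @^-1` [set y]) w))%:E))%E.
    apply: eq_integral => w _; rewrite /h' fimfunE !fsbig_finite//=.
    rewrite mulr_suml -sumEFin; apply: eq_bigr => y _.
    by rewrite mulrAC mulrA.
  rewrite ge0_integral_fsum//; first last.
  - move=> y w _; rewrite lee_fin indicE; have [|_] := boolP (w \in _).
      by rewrite inE/= => <-; rewrite !mulr_ge0.
    by rewrite !mulr0.
  - move=> y; apply/measurable_EFinP/measurable_funM => //.
    apply: measurable_funM => //; apply: measurable_indic; exact: sG.
  apply: eq_fsbigr => y /[!inE] -[v _ vy].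
  have y0 : 0 <= y by rewrite -vy; exact: h0.
  under eq_integral do rewrite EFinM.
  rewrite ge0_integralZl_EFin//.
  - congr (_ * _)%E; rewrite [RHS]integral_mkcond; apply: eq_integral => w _.
    by rewrite patchE indicE; case: ifP => _; rewrite ?mulr1// mulr0.
  - by move=> w _; rewrite lee_fin mulr_ge0.
  - apply/measurable_EFinP/measurable_funM => //.
    by apply: measurable_indic; exact: sG.
have := approx _ mY1 Y10; have := approx _ mY2 Y20 => cvg2 cvg1.
rewrite -(cvg_lim _ cvg1)// -(cvg_lim _ cvg2)//.
apply: lee_lim; [by apply/cvg_ex; eexists; exact: cvg1|
  by apply/cvg_ex; eexists; exact: cvg2|].
near=> n; rewrite !integral_h//; apply: lee_fsum => // y [v _ vy].
by apply: lee_wpmul2l; [rewrite lee_fin -vy; exact: h0|exact: Y12].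
Unshelve. all: by end_near. Qed.
End weight.

Lemma integrable_bounded_mul (R : realType) (dO : measure_display)
    (Omega : measurableType dO) (P : {measure set Omega -> \bar R})
    (K Y : Omega -> R) (C : R) :
  P.-integrable setT (EFin \o Y) -> measurable_fun setT K ->
  (forall w, `|K w| <= C) -> P.-integrable setT (fun w => (K w * Y w)%:E).
Proof.
move=> iY mK KC.
have mY : measurable_fun setT Y by exact/measurable_EFinP/measurable_int/iY.
apply: (le_integrable _ _ _ (integrableZl _ C iY)) => //.
  by apply/measurable_EFinP/measurable_funM.
move=> w _; rewrite -EFinM !abse_EFin lee_fin !normrM ler_wpM2r//.
by rewrite (le_trans (KC w))// ler_norm.
Qed.

(* Reduces to [integral_weight_le] by shifting [Y - Z] by [|Y| + |Z|] and [K]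
   by [C], which makes both nonnegative. *)
Lemma integral_weight_eq0 (R : realType) (dO : measure_display)
    (Omega : measurableType dO) (P : {measure set Omega -> \bar R})
    (G : set (set Omega)) (Y Z K : Omega -> R) (C : R) :
  <<s G >> `<=` measurable ->
  P.-integrable setT (EFin \o Y) -> P.-integrable setT (EFin \o Z) ->
  (forall A, <<s G >> A ->
    \int[P]_(w in A) (Y w)%:E = \int[P]_(w in A) (Z w)%:E)%E ->
  measurable_in G K ->
  (forall w, `|K w| <= C) ->
  (\int[P]_w (K w * (Y w - Z w))%:E = 0)%E.
Proof.
move=> sG iY iZ YZ mK KC.
have mY : measurable_fun setT Y by exact/measurable_EFinP/measurable_int/iY.
have mZ : measurable_fun setT Z by exact/measurable_EFinP/measurable_int/iZ.
have iB : P.-integrable setT (EFin \o (Y \- Z)).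
  exact: (integrableB measurableT iY iZ).
pose S : Omega -> R := fun w => `|Y w| + `|Z w|.
have iS : P.-integrable setT (EFin \o S).
  exact: (integrableD measurableT (integrable_norm iY) (integrable_norm iZ)).
have mS : measurable_fun setT S by exact/measurable_EFinP/measurable_int/iS.
pose W := fun w => K w + C.
have mW : measurable_in G W.
  exact: measurable_funD.
have mW' : measurable_fun setT W by exact: sub_measurable_fun mW.
have W0 w : 0 <= W w by have := KC w; rewrite ler_norml /W; lra.
have WC w : `|W w| <= C + C.
  by rewrite (le_trans (ler_normD _ _))// lerD// -[leRHS]ger0_norm//
    (le_trans _ (KC w)).
have S0 w : 0 <= S w by rewrite addr_ge0.
pose S' := fun w => S w + (Y w - Z w).
have iS' : P.-integrable setT (EFin \o S').
  exact: (integrableD measurableT iS iB).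
have mS' : measurable_fun setT S' by exact/measurable_EFinP/measurable_int/iS'.
have S'0 w : 0 <= S' w.
  rewrite /S' /S; have := ler_norm (- Y w); have := ler_norm (Z w).
  by rewrite normrN; lra.
have SS' A : <<s G >> A ->
    (\int[P]_(w in A) (S' w)%:E = \int[P]_(w in A) (S w)%:E)%E.
  move=> GA; have mA := sG _ GA.
  have iA (f : Omega -> R) : P.-integrable setT (EFin \o f) ->
      P.-integrable A (EFin \o f) by apply: integrableS.
  under eq_integral do rewrite EFinD EFinB.
  rewrite integralD//; [|exact: iA|exact: (iA (Y \- Z))].
  rewrite integralB_EFin//; [|exact: iA|exact: iA].
  rewrite YZ// subee ?adde0//.
  by apply: integrable_fin_num => //; exact: iA.
have E : (\int[P]_w (W w * S' w)%:E = \int[P]_w (W w * S w)%:E)%E.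
  by apply/eqP; rewrite eq_le; apply/andP; split;
    apply: (integral_weight_le sG) => // A GA; rewrite SS'.
have iWB : P.-integrable setT (fun w => (W w * (Y w - Z w))%:E).
  exact: integrable_bounded_mul WC.
have iWS : P.-integrable setT (fun w => (W w * S w)%:E).
  exact: integrable_bounded_mul WC.
have WB0 : (\int[P]_w (W w * (Y w - Z w))%:E = 0)%E.
  move: E; under eq_integral do rewrite /S' mulrDr EFinD.
  rewrite integralD//; have := integrable_fin_num measurableT iWS.
  have := integrable_fin_num measurableT iWB.
  case: (\int[P]_w _)%E => // r _; case: (\int[P]_w _)%E => // s _.
  rewrite -EFinD => -[/eqP]; rewrite addrC -subr_eq0 addrK => /eqP ->//.
transitivity (\int[P]_w ((W w * (Y w - Z w))%:E - (C * (Y w - Z w))%:E))%E.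
  by apply: eq_integral => w _; rewrite -EFinB -mulrBl /W addrK.
rewrite integralB_EFin//; last exact: (integrableZl measurableT C iB).
rewrite WB0 sub0e; under eq_integral do rewrite EFinM.
rewrite (integralZl measurableT iB) /=; under eq_integral do rewrite EFinB.
rewrite integralB_EFin// (YZ setT) ?subee ?mule0 ?oppe0//.
  exact: integrable_fin_num.
exact: (@measurableT _ (g_sigma_algebraType G)).
Qed.

Lemma condexp_le_integral (R : realType) (dO : measure_display)
    (Omega : measurableType dO) (P : probability Omega R)
    (F : set (set Omega)) (Y : Omega -> R) (c : R) (A : set Omega) :
  F `<=` measurable -> condexp_le P F Y c -> F A ->
  (\int[P]_(w in A) (Y w)%:E <= \int[P]_(w in A) c%:E)%E.
Proof.
move=> sF [Z [iY iZ mZ YZ] Zc] FA; have mA := sF _ FA.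
have mZ' : measurable_fun setT Z by exact/measurable_EFinP/measurable_int/iZ.
have iZA : P.-integrable A (EFin \o Z) by exact: integrableS iZ.
have icA : P.-integrable A (EFin \o cst c).
  exact: finite_measure_integrable_cst.
(* The bound on [Z] holds almost surely only; capping [Z] at [c] makes it hold everywhere and leaves
   the integral unchanged. *)
rewrite YZ// (ae_eq_integral (fun w => (Num.min (Z w) c)%:E))//.
- apply: le_integral => //.
    apply: (le_integrable mA _ _
      (integrableD mA (integrable_abse iZA) (integrable_abse icA))).
      apply/measurable_EFinP/measurable_funTS.
      exact: measurable_minr.
    move=> w _; rewrite /= lee_fin [leRHS]ger0_norm ?addr_ge0//.
    by rewrite /Num.min; case: ifP => _; rewrite ?lerDl ?lerDr.
  by move=> w _; rewrite lee_fin ge_min lexx orbT.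
- exact/measurable_EFinP/measurable_funTS.
- by apply/measurable_EFinP/measurable_funTS; exact: measurable_minr.
- apply: filterS Zc => w /= Zwc _.
  by rewrite min_l.
Qed.

Lemma integral_indic_mul (R : realType) (dO : measure_display)
    (Omega : measurableType dO) (P : {measure set Omega -> \bar R})
    (A : set Omega) (Y : Omega -> R) :
  (\int[P]_(w in A) (Y w)%:E = \int[P]_w (\1_A w * Y w)%:E)%E.
Proof.
rewrite integral_mkcond; apply: eq_integral => w _.
by rewrite patchE indicE; case: ifP => _; rewrite ?mul1r// mul0r.
Qed.

(** The centred term [k (Y - Z)] integrates to zero, [E] is traded for its conditional bound [c],
    and [V + W c <= 1] remains. The bounds on [k], [V] and [W] are asked on [A] only, so that [A]
    can be chosen to ensure them. *)
Lemma integral_noise_le (R : realType) (d : nat) (dO : measure_display)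
    (Omega : measurableType dO) (P : probability Omega R)
    (G : set (set Omega)) (Y Z k : 'I_d -> Omega -> R) (V W Q E : Omega -> R)
    (c C : R) (A : set Omega) :
  <<s G >> `<=` measurable ->
  (forall i, is_condexp P <<s G >> (Y i) (Z i)) ->
  condexp_le P <<s G >> E c -> (forall w, 0 <= E w) -> 0 <= c ->
  (forall i, measurable_in G (k i)) ->
  measurable_in G V ->
  measurable_in G W ->
  measurable_fun setT Q -> (forall w, 0 <= Q w) ->
  <<s G >> A ->
  (forall i w, A w -> `|k i w| <= C) ->
  (forall w, A w -> `|V w| <= C) -> (forall w, A w -> 0 <= W w <= C) ->
  (forall w, A w ->
    Q w <= \sum_(i < d) k i w * (Y i w - Z i w) + (V w + W w * E w)) ->
  (forall w, A w -> V w + W w * c <= 1) ->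
  (\int[P]_(w in A) (Q w)%:E <= P A)%E.
Proof.
move=> sG YZ Ec E0 c0 mk mV mW mQ Q0 GA kC VC WC Qle VWle.
have mA := sG _ GA.
have mIA : measurable_in G (\1_A : _ -> R).
  exact: (@measurable_indic _ (g_sigma_algebraType G)).
have mIA' : measurable_fun setT (\1_A : Omega -> R).
  exact: sub_measurable_fun mIA.
(* The maximum with 0 covers the points outside [A], where the truncated weights vanish. *)
pose C' := Num.max C 0.
have bnd (f : Omega -> R) : (forall w, A w -> `|f w| <= C) ->
    forall w, `|\1_A w * f w| <= C'.
  move=> fC w; rewrite indicE /C' le_max; have [|_] := boolP (w \in A).
    by rewrite inE => /fC; rewrite mul1r => ->.
  by rewrite mul0r normr0 lexx orbT.
have iE : P.-integrable setT (EFin \o E) by case: Ec => ? [].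
have mE : measurable_fun setT E by exact/measurable_EFinP/measurable_int/iE.
pose K i w := \1_A w * k i w.
pose V' w := \1_A w * V w.
pose W' w := \1_A w * W w.
have KC i : forall w, `|K i w| <= C' := bnd _ (kC i).
have VC' : forall w, `|V' w| <= C' := bnd _ VC.
have WC' : forall w, `|W' w| <= C'.
  by apply: bnd => w /WC/andP[W0 WC1]; rewrite ger0_norm.
have mK i : measurable_in G (K i).
  exact: measurable_funM.
have mV' : measurable_in G V'.
  exact: measurable_funM.
have mW' : measurable_in G W'.
  exact: measurable_funM.
have iYZ i : P.-integrable setT (EFin \o (Y i \- Z i)).
  by case: (YZ i) => iY iZ _ _; exact: (integrableB measurableT iY iZ).
have iK i : P.-integrable setT (fun w => (K i w * (Y i w - Z i w))%:E).
  exact: (integrable_bounded_mul (iYZ i) (sub_measurable_fun sG (mK i)) (KC i)).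
have icst (r : R) : P.-integrable setT (EFin \o (cst r : Omega -> R)).
  exact: finite_measure_integrable_cst.
have iV : P.-integrable setT (EFin \o V').
  apply: eq_integrable (integrable_bounded_mul (icst 1)
    (sub_measurable_fun sG mV') VC') => //.
  by move=> w _; rewrite /= mulr1.
have iWE : P.-integrable setT (fun w => (W' w * E w)%:E).
  exact: (integrable_bounded_mul iE (sub_measurable_fun sG mW') WC').
have iWc : P.-integrable setT (fun w => (W' w * c)%:E).
  exact: (integrable_bounded_mul (icst c) (sub_measurable_fun sG mW') WC').
have W'0 w : 0 <= W' w.
  rewrite /W' indicE; have [|_] := boolP (w \in A); last by rewrite mul0r.
  by rewrite inE => /WC/andP[W0 _]; rewrite mul1r.
have iKs : P.-integrable setT
    (fun w => (\sum_(i < d) (K i w * (Y i w - Z i w))%:E)%E).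
  by apply: integrable_sum => // i _.
have iVWE : P.-integrable setT (fun w => ((V' w)%:E + (W' w * E w)%:E)%E).
  exact: (integrableD measurableT iV iWE).
have Ks0 : (\int[P]_w (\sum_(i < d) (K i w * (Y i w - Z i w))%:E) = 0)%E.
  rewrite integral_sum// big1// => i _.
  case: (YZ i) => iY iZ _ YZi.
  exact: (integral_weight_eq0 sG iY iZ YZi (mK i) (KC i)).
rewrite integral_indic_mul.
apply: (@le_trans _ _ (\int[P]_w (\sum_(i < d) (K i w * (Y i w - Z i w))%:E
    + ((V' w)%:E + (W' w * E w)%:E)))%E).
  apply: ge0_le_integral => //.
  - by move=> w _; rewrite lee_fin mulr_ge0.
  - exact/measurable_EFinP/measurable_funM.
  - exact: (measurable_int _ (integrableD measurableT iKs iVWE)).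
  - move=> w _; rewrite sumEFin -!EFinD lee_fin /K /V' /W' indicE.
    have [|_] := boolP (w \in A).
      rewrite inE => /Qle; rewrite !mul1r => /le_trans; apply.
      by rewrite lerD2r; apply: ler_sum => i _; rewrite mul1r.
    by rewrite !mul0r addr0 addr0 big1// => i _; rewrite !mul0r.
rewrite (integralD measurableT iKs iVWE) Ks0 add0e.
rewrite (integralD measurableT iV iWE).
have WEc : (\int[P]_w (W' w * E w)%:E <= \int[P]_w (W' w * c)%:E)%E.
  apply: (@integral_weight_le _ _ _ _ G _ (cst c)) => // B GB.
  exact: condexp_le_integral Ec GB.
apply: (le_trans (leeD2l _ WEc)).
rewrite -(integralD measurableT iV iWc).
have -> : P A = (\int[P]_w (\1_A w)%:E)%E by rewrite integral_indic// setIT.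
apply: le_integral => //.
- exact: (integrableD measurableT iV iWc).
- apply: eq_integrable (integrable_bounded_mul (icst 1) mIA' (C := 1) _) => //.
    by move=> w _; rewrite /= mulr1.
  by move=> w; rewrite indicE; case: (_ \in _); rewrite ?normr1 ?normr0.
- move=> w _; rewrite -EFinD lee_fin /V' /W' indicE.
  have [|_] := boolP (w \in A); last by rewrite !mul0r addr0.
  by rewrite inE !mul1r => /VWle.
Qed.

(** * Exponential moments of the noise *)

Lemma sqr_coord_le (R : realType) (d : nat) (v : 'rV[R]_d) (i : 'I_d) :
  v 0 i ^+ 2 <= dot v v.
Proof.
rewrite /dot (bigD1 i)//= expr2 lerDl sumr_ge0// => j _.
by rewrite -expr2 sqr_ge0.
Qed.

Lemma measurable_dot (R : realType) (d : nat) (dT : measure_display)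
    (T : measurableType dT) (u v : T -> 'rV[R]_d) :
  (forall i, measurable_fun setT (fun w => u w 0 i)) ->
  (forall i, measurable_fun setT (fun w => v w 0 i)) ->
  measurable_fun setT (fun w => dot (u w) (v w)).
Proof.
by move=> mu mv; apply: measurable_sum => i; exact: measurable_funM.
Qed.

Lemma inv_sqrt_le (R : realType) (x r : R) :
  0 < r -> 1 <= r ^+ 2 * x -> 1 / Num.sqrt x <= r.
Proof.
move=> r0 rx.
have x0 : 0 < x by rewrite -(pmulr_rgt0 _ (exprn_gt0 2 r0)) (lt_le_trans ltr01).
rewrite ler_pdivrMr ?sqrtr_gt0// -[r]ger0_norm; last exact: ltW.
rewrite -sqrtr_sqr -sqrtrM ?sqr_ge0// -[leLHS]sqrtr1.
by rewrite ler_sqrt// (le_trans _ rx).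
Qed.

Section noise.
Variables (R : realType) (d : nat) (dO : measure_display).
Variables (Omega : measurableType dO) (P : probability Omega R).
Variables (G : set (set Omega)) (g h : Omega -> 'rV[R]_d).
Hypothesis sG : <<s G >> `<=` measurable.
Hypothesis unbiased : forall i,
  is_condexp P <<s G >> (fun w => g w 0 i) (fun w => h w 0 i).
Hypothesis light_tailed : forall t : R, 0 < t < 1 / 2 ->
  condexp_le P <<s G >> (fun w => expR (t * enorm (g w - h w) ^+ 2))
    (1 / Num.sqrt (1 - 2 * t)).

Let mg i : measurable_fun setT (fun w => g w 0 i).
Proof.
by case: (unbiased i) => ig _ _ _; exact/measurable_EFinP/measurable_int/ig.
Qed.

Let mh i : measurable_fun setT (fun w => h w 0 i).
Proof.
by case: (unbiased i) => _ ih _ _; exact/measurable_EFinP/measurable_int/ih.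
Qed.

Let mz i : measurable_fun setT (fun w => (g w - h w) 0 i).
Proof.
rewrite (_ : (fun _ => _) = (fun w => g w 0 i - h w 0 i)).
  exact: measurable_funB.
by apply/funext => w; rewrite !mxE.
Qed.

(** [A] is cut into three parts according to [u = |b|^2], which is known in advance. On the first
    two [b] is bounded, so the linear term is integrable and has mean zero; on the third [b] may be
    unbounded, and there no linear term occurs. *)
Lemma subgaussian_noise (b : Omega -> 'rV[R]_d) (A : set Omega) :
  (forall i, measurable_in G (fun w => b w 0 i)) ->
  <<s G >> A ->
  (\int[P]_(w in A) (expR (dot (b w) (g w - h w) - 2 * dot (b w) (b w)))%:E
    <= P A)%E.
Proof.
move=> mb GA.
pose u w := dot (b w) (b w).
pose Q w := expR (dot (b w) (g w - h w) - 2 * u w).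
have u0 w : 0 <= u w by exact: dotvv_ge0.
have mu : measurable_in G u.
  exact: measurable_dot.
have mb' i : measurable_fun setT (fun w => b w 0 i).
  exact: sub_measurable_fun (mb i).
have mu' : measurable_fun setT u by exact: sub_measurable_fun mu.
have mQ : measurable_fun setT Q.
  apply: measurableT_comp => //; apply: measurable_funB.
    exact: measurable_dot.
  exact: measurable_funM.
have mZ (r : R) : measurable_in G (fun w => r * u w).
  exact: measurable_funM.
have mexp (r : R) : measurable_in G (fun w => expR (r * u w)).
  exact: measurableT_comp.
have mexpN : measurable_in G (fun w => expR (- (2 * u w))).
  by apply: measurableT_comp => //; exact: measurableT_comp.
have QE w : Q w = expR (- (2 * u w)) * expR (dot (b w) (g w - h w)).
  by rewrite -expRD addrC.
have exp01 w : 0 <= expR (- (2 * u w)) <= 1.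
  by rewrite expR_ge0 -expR0 ler_expR oppr_le0 mulr_ge0.
have dotE w (i : R) : i * dot (b w) (g w - h w) =
    \sum_(j < d) i * b w 0 j * (g w 0 j - h w 0 j).
  by rewrite mulr_sumr; apply: eq_bigr => j _; rewrite !mxE mulrA.
have CS' w : dot (b w) (g w - h w) ^+ 2 <= u w * enorm (g w - h w) ^+ 2.
  by rewrite sqr_enorm; exact: cauchy_schwarz_sqr.
pose A1 := A `&` [set w | u w <= 1 / 4].
pose A2 := A `&` [set w | 1 / 4 < u w <= 28 / 81].
pose A3 := A `&` [set w | 28 / 81 < u w].
have GI (I : interval R) : <<s G >> (A `&` [set w | u w \in I]).
  apply: (@measurableI _ (g_sigma_algebraType G)) => //.
  by have := mu measurableT _ (measurable_itv I); rewrite setTI.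
have GA1 : <<s G >> A1.
  by have := GI `]-oo, (1 / 4)]; congr (<<s G >> (A `&` _)).
have GA2 : <<s G >> A2.
  by have := GI `](1 / 4), (28 / 81)]; congr (<<s G >> (A `&` _)).
have GA3 : <<s G >> A3.
  have := GI `](28 / 81), +oo[; congr (<<s G >> (A `&` _)).
  by apply/seteqP; split => w /=; rewrite in_itv/= andbT.
have b1 w i : u w <= 1 -> `|b w 0 i| <= 1.
  move=> u1; rewrite -(@ler_pXn2r _ 2)// ?nnegrE// real_normK ?num_real//.
  by rewrite expr1n (le_trans (sqr_coord_le _ _)).
have eb1 w i : u w <= 1 -> `|expR (- (2 * u w)) * b w 0 i| <= 1.
  move=> u1; rewrite normrM mulr_ile1// ?b1// ger0_norm ?expR_ge0//.
  by case/andP: (exp01 w).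
have mk i : measurable_in G
    (fun w => expR (- (2 * u w)) * b w 0 i) by exact: measurable_funM.
have mW r : measurable_in G
    (fun w => expR (- (2 * u w)) * (r * u w)) by exact: measurable_funM.
have mV r : measurable_in G
    (fun w => expR (- (2 * u w)) * (1 - r * u w)).
  by apply: measurable_funM => //; exact: measurable_funB.
have eE t w : 0 <= expR (t * enorm (g w - h w) ^+ 2) by exact: expR_ge0.
have le1 : (\int[P]_(w in A1) (Q w)%:E <= P A1)%E.
  have c32 : 1 / Num.sqrt (1 - 2 * (1 / 4)) <= 3 / 2 :> R.
    by apply: inv_sqrt_le; lra.
  apply: (@integral_noise_le _ _ _ _ _ _ _ _ _ _ _ _ _ _ 1 _ sG unbiased
    (light_tailed (t := 1 / 4) _) (eE _) _ mk (mV 4) (mW 4)) => //.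
  - by lra.
  - by move=> w; exact: expR_ge0.
  - by move=> i w [_ /= u1]; apply: eb1; lra.
  - move=> w [_ /= u1]; have := exp01 w; have := u0 w.
    move: (expR _) => e; move: (u w) u1 => v v1 v0 e1.
    by rewrite ger0_norm; nra.
  - move=> w [_ /= u1]; have := exp01 w; have := u0 w.
    move: (expR _) => e; move: (u w) u1 => v v1 v0 e1.
    by apply/andP; split; nra.
  - move=> w [_ /= u1]; rewrite QE -dotE -mulrA -!mulrDr.
    rewrite ler_wpM2l ?expR_ge0//; apply: expR_small; last exact: CS'.
    by rewrite u0.
  - by move=> w [_ /= u1]; apply: small_budget => //; rewrite u0.
have le2 : (\int[P]_(w in A2) (Q w)%:E <= P A2)%E.
  have c95 : 1 / Num.sqrt (1 - 2 * (28 / 81)) <= 9 / 5 :> R.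
    by apply: inv_sqrt_le; lra.
  apply: (@integral_noise_le _ _ _ _ _ _ _ _ _ _ _ _ _ _ 1 _ sG unbiased
    (light_tailed (t := 28 / 81) _) (eE _) _ mk (mV (81 / 28))
    (mW (81 / 28))) => //.
  - by lra.
  - by move=> w; exact: expR_ge0.
  - by move=> i w [_ /= /andP[_ u1]]; apply: eb1; lra.
  - move=> w [_ /= /andP[_ u1]]; have := exp01 w; have := u0 w.
    move: (expR _) => e; move: (u w) u1 => v v1 v0 e1.
    by rewrite ger0_norm; nra.
  - move=> w [_ /= /andP[_ u1]]; have := exp01 w; have := u0 w.
    move: (expR _) => e; move: (u w) u1 => v v1 v0 e1.
    by apply/andP; split; nra.
  - move=> w [_ /= /andP[_ u1]]; rewrite QE -dotE -mulrA -!mulrDr.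
    rewrite ler_wpM2l ?expR_ge0//; apply: expR_medium; last exact: CS'.
    by rewrite u0.
  - move=> w [_ /= /andP[u1 u2]]; apply: medium_budget => //.
    by rewrite u2 ltW.
have le3 : (\int[P]_(w in A3) (Q w)%:E <= P A3)%E.
  have c43 : 1 / Num.sqrt (1 - 2 * (7 / 32)) <= 4 / 3 :> R.
    by apply: inv_sqrt_le; lra.
  have mW3 : measurable_in G
    (fun w => expR (- (2 * u w)) * expR (8 / 7 * u w)).
    exact: measurable_funM.
  apply: (@integral_noise_le _ _ _ _ _ _ _ _ (fun _ _ => 0) (fun _ => 0)
    _ _ _ _ 1 _ sG unbiased
    (light_tailed (t := 7 / 32) _) (eE _) _ _ _ mW3) => //.
  - by lra.
  - by move=> w; exact: expR_ge0.
  - by move=> i w _; rewrite normr0.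
  - by move=> w _; rewrite normr0.
  - move=> w _; rewrite mulr_ge0 ?expR_ge0//= -expRD -[leRHS]expR0 ler_expR.
    by have := u0 w; lra.
  - move=> w _; rewrite QE big1 ?add0r; last by move=> i _; rewrite mul0r.
    rewrite -mulrA ler_wpM2l ?expR_ge0//; apply: expR_large => //.
    exact: sqr_ge0.
  - by move=> w [_ /= /ltW u1]; rewrite add0r; exact: large_budget.
have AE : A = A1 `|` A2 `|` A3.
  apply/seteqP; split=> [w Aw|w [[]|] []//].
  have [u1|u1] := leP (u w) (1 / 4); first by left; left.
  have [u2|u2] := leP (u w) (28 / 81); last by right.
  by left; right; split => //=; rewrite u1.
have mA1 := sG GA1; have mA2 := sG GA2; have mA3 := sG GA3.
have d12 : [disjoint A1 & A2].
  apply/disj_setPS => w [[_ /= u1] [_ /= /andP[u2 _]]].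
  by move: u2; rewrite ltNge u1.
have d123 : [disjoint A1 `|` A2 & A3].
  apply/disj_setPS => w [[[_ /= u1]|[_ /= /andP[_ u1]]] [_ /= u2]];
    by move: u2; lra.
have mQE (B : set Omega) : measurable_fun B (EFin \o Q).
  by apply/measurable_EFinP; exact: measurable_funTS.
have mA12 : measurable (A1 `|` A2) by exact: measurableU.
rewrite AE ge0_integral_setU//.
rewrite ge0_integral_setU//.
rewrite !measureU//; first by rewrite leeD// leeD.
- by apply/eqP; rewrite -disj_set2E.
- by apply/eqP; rewrite -disj_set2E.
Qed.

(** Young's inequality separates the linear from the quadratic noise. The subgaussian bound for
    [b = 3/2 a] costs [2/3 * 2 * 9/4 |a|^2 = 3 |a|^2], the square costs [1/3 * 6 s = 2 s], and
    [s <= 1/8] keeps [3 s] at most 3/8, within the range of the tail bound. *)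
Lemma noise_step (s : R) (a : Omega -> 'rV[R]_d) (A : set Omega) :
  0 < s <= 1 / 8 ->
  (forall i, measurable_in G (fun w => a w 0 i)) ->
  <<s G >> A ->
  (\int[P]_(w in A) (expR (dot (a w) (g w - h w) + s * enorm (g w - h w) ^+ 2
     - 3 * dot (a w) (a w) - 2 * s))%:E <= P A)%E.
Proof.
move=> /andP[s0 s1] ma GA; have mA := sG GA.
have ma' i : measurable_fun setT (fun w => a w 0 i).
  exact: sub_measurable_fun (ma i).
pose b w := (3 / 2) *: a w.
have mb i : measurable_in G (fun w => b w 0 i).
  rewrite (_ : (fun _ => _) = (fun w => 3 / 2 * a w 0 i)).
    exact: measurable_funM.
  by apply/funext => w; rewrite mxE.
have mb' i : measurable_fun setT (fun w => b w 0 i).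
  exact: sub_measurable_fun (mb i).
pose Q1 w := expR (dot (b w) (g w - h w) - 2 * dot (b w) (b w)).
pose Q2 w := expR (3 * (s * enorm (g w - h w) ^+ 2) - 3 * (2 * s)).
have menorm : measurable_fun setT (fun w => enorm (g w - h w) ^+ 2).
  rewrite (_ : (fun _ => _) = fun w => dot (g w - h w) (g w - h w)).
    exact: measurable_dot.
  by apply/funext => w; rewrite sqr_enorm.
have mQ1 : measurable_fun setT Q1.
  apply: measurableT_comp => //.
  apply: measurable_funB; first exact: measurable_dot.
  by apply: measurable_funM => //; exact: measurable_dot.
have mQ2 : measurable_fun setT Q2.
  apply: measurableT_comp => //; apply: measurable_funB => //.
  by apply: measurable_funM => //; exact: measurable_funM.
have Q1le : (\int[P]_(w in A) (Q1 w)%:E <= P A)%E by exact: subgaussian_noise.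
have Q2le : (\int[P]_(w in A) (Q2 w)%:E <= P A)%E.
  have t01 : 0 < 3 * s < 1 / 2 by lra.
  apply: (@integral_noise_le _ _ _ _ _ _ _ _ (fun _ _ => 0) (fun _ => 0)
    (fun _ => expR (- (6 * s))) _ _ _ 1 _ sG unbiased (light_tailed t01)) => //.
  - by move=> w; exact: expR_ge0.
  - by move=> _ w _; rewrite normr0.
  - by move=> w _; rewrite normr0.
  - move=> w _; rewrite expR_ge0/= -[leRHS]expR0 ler_expR; lra.
  - move=> w _; rewrite big1 ?add0r; last by move=> i _; rewrite mul0r.
    by rewrite -expRD ler_expR; lra.
  - by move=> w _; rewrite add0r; apply: chi_square_le; rewrite s0.
apply: (@le_trans _ _ (\int[P]_(w in A) ((2 / 3)%:E * (Q1 w)%:E +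
    (1 / 3)%:E * (Q2 w)%:E))%E).
  apply: ge0_le_integral => //.
  - apply/measurable_EFinP/measurable_funTS; apply: measurableT_comp => //.
    apply: measurable_funB => //; apply: measurable_funB.
      apply: measurable_funD; first exact: measurable_dot.
      exact: measurable_funM.
    by apply: measurable_funM => //; exact: measurable_dot.
  - apply: emeasurable_funD; apply/measurable_EFinP/measurable_funTS;
      exact: measurable_funM.
  - move=> w _; rewrite -!EFinM -EFinD lee_fin.
    apply: le_trans (expR_young _ _ _ _) _.
    rewrite /Q1 /b dotZl dotZr dotZl; apply: lerD => //; rewrite ler_wpM2l//.
    by rewrite ler_expR; lra.
rewrite ge0_integralD//.
- rewrite !ge0_integralZl_EFin//.
  + apply: (@le_trans _ _ ((2 / 3)%:E * P A + (1 / 3)%:E * P A)%E).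
      by apply: leeD; apply: lee_wpmul2l.
    rewrite -muleDl//; last by rewrite fin_num_measure.
    by rewrite -EFinD (_ : 2 / 3 + 1 / 3 = 1) ?mul1e//; field.
  + by move=> w _; rewrite lee_fin expR_ge0.
  + exact/measurable_EFinP/measurable_funTS.
  + by move=> w _; rewrite lee_fin expR_ge0.
  + exact/measurable_EFinP/measurable_funTS.
- by move=> w _; rewrite -EFinM lee_fin mulr_ge0 ?expR_ge0.
- by apply/measurable_EFinP/measurable_funTS; exact: measurable_funM.
- by move=> w _; rewrite -EFinM lee_fin mulr_ge0 ?expR_ge0.
- by apply/measurable_EFinP/measurable_funTS; exact: measurable_funM.
Qed.
End noise.

(** * Maximal inequality *)

(** Stopping at the first crossing, by induction on the horizon: with [S m] the event of no crossing
    before [m], the integral of [M m] over [S m] plus [lam] times the probability of an earlier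
    crossing does not increase with [m]. *)
Lemma maximal_inequality (R : realType) (dO : measure_display)
    (Omega : measurableType dO) (P : probability Omega R)
    (G : nat -> set (set Omega)) (M : nat -> Omega -> R) (lam : R) (n : nat) :
  (forall k, <<s G k >> `<=` measurable) ->
  (forall k, <<s G k >> `<=` <<s G k.+1 >>) ->
  (forall k, measurable_in (G k) (M k)) ->
  (forall k w, 0 <= M k w) -> 0 <= lam ->
  (forall k A, <<s G k >> A ->
    (\int[P]_(w in A) (M k.+1 w)%:E <= \int[P]_(w in A) (M k w)%:E)%E) ->
  (lam%:E * P [set w | exists2 k, (k < n)%N & (lam < M k w)%R] <=
    \int[P]_w (M 0%N w)%:E)%E.
Proof.
move=> sG mono mM M0 lam0 super.
pose S m := [set w | forall k, (k < m)%N -> M k w <= lam].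
have Sle k : <<s G k >> [set w | M k w <= lam].
  by have := mM k measurableT _ (measurable_itv `]-oo, lam]); rewrite setTI.
have SS m : S m.+1 = S m `&` [set w | M m w <= lam].
  apply/seteqP; split=> [w Sw|w [Sw Mw] k].
    by split=> [k km|]; apply: Sw => //; rewrite ltnS ltnW.
  by rewrite ltnS leq_eqVlt => /predU1P[->//|/Sw].
have S0 : S 0%N = setT by apply/seteqP; split.
have GS m : <<s G m >> (S m).
  elim: m => [|m IHm].
    by rewrite S0; exact: (@measurableT _ (g_sigma_algebraType _)).
  rewrite SS; apply: mono.
  exact: (@measurableI _ (g_sigma_algebraType (G m)) _ _ IHm (Sle m)).
have mS m : measurable (S m) by exact: sG (GS m).
have mMO m : measurable_fun setT (M m) by exact: sub_measurable_fun (mM m).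
have key m : (\int[P]_(w in S m) (M m w)%:E + lam%:E * P (~` S m) <=
    \int[P]_w (M 0%N w)%:E)%E.
  elim: m => [|m IHm]; first by rewrite S0 setCT measure0 mule0 adde0.
  apply: le_trans IHm.
  (* The first crossing occurs exactly at [m] on [H]: there [M m > lam] pays for the added
     probability, and on the rest of [S m] the supermartingale property applies. *)
  pose H := S m `&` [set w | lam < M m w].
  have mH : measurable H.
    apply: measurableI => //.
    have := mMO m measurableT _ (measurable_itv `]lam, +oo[).
    rewrite setTI; congr measurable.
    by apply/seteqP; split => w /=; rewrite in_itv/= andbT.
  have SE : S m = S m.+1 `|` H.
    rewrite SS /H; apply/seteqP; split=> [w Sw|w [[]|[]]//].
    by have [h|h] := leP (M m w) lam; [left|right].
  have d1 : S m.+1 `&` H = set0.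
    rewrite SS /H; apply/seteqP; split=> [w [[_ /= h1] [_ /= h2]]|//].
    by move: h2; rewrite ltNge h1.
  have CE : ~` S m.+1 = ~` S m `|` H.
    rewrite SS /H setCI; apply/seteqP; split=> w /=.
      have [Sw|] := pselect (S m w); last by left.
      by case=> // /negP; rewrite -ltNge; right.
    case=> [|[_ h]]; first by left.
    by right; apply/negP; rewrite -ltNge.
  have d2 : ~` S m `&` H = set0.
    by rewrite /H; apply/seteqP; split=> [w [h1 [h2 _]]|//]; exact: h1.
  have -> : (\int[P]_(w in S m) (M m w)%:E =
      \int[P]_(w in S m.+1) (M m w)%:E + \int[P]_(w in H) (M m w)%:E)%E.
    rewrite SE ge0_integral_setU//.
    - exact/measurable_EFinP/measurable_funTS.
    - by move=> w _; rewrite lee_fin.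
    - by rewrite disj_set2E d1.
  rewrite CE measureU//; last exact: measurableC.
  rewrite muleDr//.
    rewrite addeA (addeAC _ _ (lam%:E * P H)%E) leeD2r//.
    apply: leeD; last first.
      rewrite -integral_cst//; apply: ge0_le_integral => //.
        exact/measurable_EFinP/measurable_funTS.
      by move=> w [_ /= /ltW].
    apply: super; rewrite SS.
    exact: (@measurableI _ (g_sigma_algebraType (G m)) _ _ (GS m) (Sle m)).
  by rewrite ge0_adde_def// inE measure_ge0.
rewrite (_ : [set w | _] = ~` S n); last first.
  apply/seteqP; split=> [w [k kn h] Sw|w /existsNP[k /not_implyP[kn /negP]]].
    by move: h; rewrite ltNge Sw.
  by rewrite -ltNge; exists k.
apply: le_trans (key n); rewrite leeDr//.
by apply: integral_ge0 => w _; rewrite lee_fin.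
Qed.

(** * Stochastic gradient descent *)

Lemma past_mono (dO dX : measure_display) (Omega : measurableType dO)
    (X : measurableType dX) (xi : nat -> Omega -> X) (k : nat) :
  past xi k `<=` past xi k.+1.
Proof.
apply: sub_sigma_algebra2 => A [i ik Ai]; exists i => //.
by rewrite /= ltnS ltnW.
Qed.

Lemma past_measurable (dO dX : measure_display) (Omega : measurableType dO)
    (X : measurableType dX) (xi : nat -> Omega -> X) (k : nat) :
  (forall i, measurable_fun setT (xi i)) -> past xi k `<=` measurable.
Proof.
move=> mxi; apply: smallest_sub; first exact: sigma_algebra_measurable.
by move=> _ [i _ [B mB <-]]; exact: mxi.
Qed.

Section sgd.
Variables (R : realType) (d : nat) (f : 'rV[R]_d -> R) (mu L fstar : R).
Hypotheses (mu_gt0 : 0 < mu) (L_gt0 : 0 < L).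
Hypothesis f_strongly_convex : strongly_convex mu f.
Hypothesis f_smooth : smooth L f.
Hypothesis fstar_min : is_minimum f fstar.
Variables (dO : measure_display) (Omega : measurableType dO).
Variables (P : probability Omega R) (G : nat -> set (set Omega)).
Hypothesis G_measurable : forall k, <<s G k >> `<=` measurable.
Hypothesis G_mono : forall k, <<s G k >> `<=` <<s G k.+1 >>.
Variables (B : R) (B_ge3 : 3 <= B) (B_geL : 4 * L <= mu * B).
Variables (x0 : 'rV[R]_d) (x gk : nat -> Omega -> 'rV[R]_d).
Hypothesis x_init : forall w, x 0%N w = x0.
Hypothesis x_step : forall k w,
  x k.+1 w = x k w - (4 / (mu * (k%:R + B))) *: gk k w.
Hypothesis gk_measurable : forall k i,
  measurable_wrt <<s G k.+1 >> (fun w => gk k w 0 i).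
Hypothesis gk_unbiased : forall k i,
  is_condexp P <<s G k >> (fun w => gk k w 0 i) (fun w => grad f (x k w) 0 i).
Hypothesis gk_light_tailed : forall (k : nat) (t : R), 0 < t < 1 / 2 ->
  condexp_le P <<s G k >>
    (fun w => expR (t * enorm (gk k w - grad f (x k w)) ^+ 2))
    (1 / Num.sqrt (1 - 2 * t)).

Let gap k w := f (x k w) - fstar.
Let kappa k := k%:R + B - 1.

Let gap_ge0 k w : 0 <= gap k w.
Proof. by rewrite subr_ge0; case: fstar_min. Qed.

Let kappa_ge2 k : 2 <= kappa k.
Proof. by have := ler0n R k; have := B_ge3; rewrite /kappa; lra. Qed.

Lemma sgd_adapted k i :
  measurable_in (G k) (fun w => x k w 0 i).
Proof.
elim: k => [|k IHk].
  rewrite (_ : (fun _ => _) = cst (x0 0 i)); first exact: measurable_cst.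
  by apply/funext => w; rewrite x_init.
rewrite (_ : (fun _ => _) =
    (fun w => x k w 0 i - 4 / (mu * (k%:R + B)) * gk k w 0 i)).
  apply: measurable_funB; first exact: g_sigma_measurable_funS IHk.
  by apply: measurable_funM => //; exact/measurable_wrtP.
by apply/funext => w; rewrite x_step !mxE.
Qed.

Lemma gap_measurable k :
  measurable_in (G k) (gap k).
Proof.
apply: measurable_funB => //.
apply: (measurable_continuous_comp (f := f)) => [i|].
  exact: sgd_adapted.
by move=> y; apply: differentiable_continuous; case: f_smooth.
Qed.

Let V k w := mu * kappa k / 16 * gap k w.

Let V_ge0 k w : 0 <= V k w.
Proof.
rewrite mulr_ge0// divr_ge0// mulr_ge0// ?ltW//.
by rewrite (lt_le_trans _ (kappa_ge2 k)).
Qed.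

Let expV_measurable k (c e : R) :
  measurable_in (G k) (fun w => expR (c * V k w + e)).
Proof.
apply: measurableT_comp => //; apply: measurable_funD => //.
by do 2!apply: measurable_funM => //; exact: gap_measurable.
Qed.

Let expVD_measurable k (e : R) :
  measurable_in (G k) (fun w => expR (V k w + e)).
Proof.
rewrite (_ : (fun _ => _) = fun w => expR (1 * V k w + e)).
  exact: expV_measurable.
by apply/funext => w; rewrite mul1r.
Qed.

(** [exp(V_{k+1} + c)] is at most [W * Q] with [W] known at time [k] and [Q] the normalised noise
    factor, of conditional mean at most 1. The free constant [c] carries the drift correction of a
    block. *)
Lemma mgf_step k (c : R) (A : set Omega) : <<s G k >> A ->
  (\int[P]_(w in A) (expR (V k.+1 w + c))%:E <=
   \int[P]_(w in A) (expR ((1 - (kappa k)^-1) * V k w +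
      (L / (mu * (k%:R + B)) + c)))%:E)%E.
Proof.
move=> GA; have mA := G_measurable GA.
have kB : kappa k + 1 = k%:R + B by rewrite /kappa subrK.
have kS : kappa k.+1 = kappa k + 1 by rewrite /kappa -(@natr1 R k); ring.
have k0 : 0 < kappa k by rewrite (lt_le_trans _ (kappa_ge2 k)).
pose eta := 4 / (mu * (kappa k + 1)).
pose s := L * eta / 8.
have sE : 2 * s = L / (mu * (k%:R + B)).
  by rewrite /s /eta kB; field; rewrite -kB !gt_eqF//; lra.
have eta0 : 0 < eta by rewrite divr_gt0// mulr_gt0//; lra.
have Leta : L * eta <= 1.
  rewrite /eta mulrA ler_pdivrMr ?mul1r; last by rewrite mulr_gt0//; lra.
  rewrite kB mulrC (le_trans B_geL)// ler_pM2l// lerDr; exact: ler0n.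
have s01 : 0 < s <= 1 / 8.
  by have := mulr_gt0 L_gt0 eta0; rewrite /s; move: (L * eta) Leta => r; lra.
pose z w := gk k w - grad f (x k w).
pose a w := - ((1 - L * eta) / 4) *: grad f (x k w).
pose Q w := expR (dot (a w) (z w) + s * enorm (z w) ^+ 2 -
  3 * dot (a w) (a w) - 2 * s).
have ma i : measurable_in (G k) (fun w => a w 0 i).
  rewrite (_ : (fun _ => _) =
      fun w => - ((1 - L * eta) / 4) * grad f (x k w) 0 i).
    (* The gradient is known at time [k] because it is a version of a conditional expectation given
       [F_k]. *)
    apply: measurable_funM => //; apply/measurable_wrtP.
    by case: (gk_unbiased k i).
  by apply/funext => w; rewrite mxE.
have Qle A' : <<s G k >> A' -> (\int[P]_(w in A') (Q w)%:E <= P A')%E.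
  move=> GA'; apply: (noise_step (@G_measurable k) (gk_unbiased k)
    (gk_light_tailed k)) => //.
pose W w := expR ((1 - (kappa k)^-1) * V k w + (L / (mu * (k%:R + B)) + c)).
have stepW w : expR (V k.+1 w + c) <= W w * Q w.
  rewrite /W /Q -expRD ler_expR -sE.
  have := @sgd_step _ _ mu L fstar f (x k w) (gk k w) (z w) (a w) eta (kappa k)
    mu_gt0 L_gt0 f_strongly_convex f_smooth fstar_min k0 erefl Leta erefl erefl.
  have -> : x k w - eta *: gk k w = x k.+1 w by rewrite x_step /eta kB.
  have -> : mu * (kappa k + 1) / 16 * (f (x k.+1 w) - fstar) = V k.+1 w.
    by rewrite /V kS.
  have -> : mu * (kappa k - 1) / 16 * (f (x k w) - fstar) =
      (1 - (kappa k)^-1) * V k w.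
    by rewrite /V /gap; field; rewrite gt_eqF.
  rewrite -/s; move: (V k.+1 w) (_ * V k w) (dot _ _) (s * enorm _ ^+ 2).
  by move: (dot _ _) (2 * s) => ? ? ? ? ? ?; lra.
have mW : measurable_in (G k) W.
  exact: expV_measurable.
have mW' : measurable_fun setT W by exact: sub_measurable_fun mW.
have mz i : measurable_fun setT (fun w => z w 0 i).
  rewrite (_ : (fun _ => _) = fun w => gk k w 0 i - grad f (x k w) 0 i).
    case: (gk_unbiased k i) => i1 i2 _ _.
    by apply: measurable_funB; apply/measurable_EFinP;
      [exact: measurable_int i1|exact: measurable_int i2].
  by apply/funext => w; rewrite !mxE.
have ma' i : measurable_fun setT (fun w => a w 0 i).
  exact: sub_measurable_fun (ma i).
have mQ : measurable_fun setT Q.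
  apply: measurableT_comp => //; apply: measurable_funB => //.
  apply: measurable_funB; last first.
    by apply: measurable_funM => //; exact: measurable_dot.
  apply: measurable_funD; first exact: measurable_dot.
  rewrite (_ : (fun _ => _) = fun w => s * dot (z w) (z w)).
    by apply: measurable_funM => //; exact: measurable_dot.
  by apply/funext => w; rewrite sqr_enorm.
have mIA : measurable_in (G k) (\1_A : _ -> R).
  exact: (@measurable_indic _ (g_sigma_algebraType (G k))).
apply: (@le_trans _ _ (\int[P]_(w in A) (W w * Q w)%:E)%E).
  apply: ge0_le_integral => //.
  - apply/measurable_EFinP/measurable_funTS.
    exact: sub_measurable_fun (@expVD_measurable k.+1 c).
  - exact/measurable_EFinP/measurable_funTS/measurable_funM.
  - by move=> w _; rewrite lee_fin.
rewrite integral_indic_mul [leRHS]integral_indic_mul.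
under eq_integral do rewrite mulrA.
(* The factor 1 is the constant function with which [Q] is compared. *)
under [leRHS]eq_integral do rewrite -[_ * expR _]mulr1.
apply: (@integral_weight_le _ _ _ _ (G k) Q (cst 1)
  (fun w => \1_A w * W w)) => //.
- by move=> w; exact: expR_ge0.
- move=> A' GA'; apply: (le_trans (Qle _ GA')).
  by rewrite -[leLHS]mul1e -integral_cst//; exact: G_measurable GA'.
- exact: measurable_funM.
- by move=> w; rewrite mulr_ge0 ?expR_ge0.
Qed.

Let V0 := mu * kappa 0 / 16 * (f x0 - fstar).
(** From the level [L / mu] upwards, the contraction [K / kappa] outweighs the drift
    [L / (mu (kappa + 1))] at every step; [V0] is added to cover the start. *)
Let K := V0 + L / mu.

Lemma mgf_bound k : (\int[P]_w (expR (V k w))%:E <= (expR K)%:E)%E.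
Proof.
have Lmu0 : 0 < L / mu by rewrite divr_gt0.
have V00 : 0 <= V0.
  rewrite mulr_ge0 ?subr_ge0 ?(fstar_min.2)// divr_ge0// mulr_ge0// ?ltW//.
  by rewrite (lt_le_trans _ (kappa_ge2 0)).
elim: k => [|k IHk].
  have E w : (expR (V 0%N w))%:E = (expR V0)%:E by rewrite /V /V0 /gap x_init.
  under eq_integral do rewrite E.
  rewrite integral_cst//; apply: (@le_trans _ _ ((expR V0)%:E * 1)%E).
    by apply: lee_wpmul2l; [rewrite lee_fin expR_ge0|exact: probability_le1].
  by rewrite mule1 lee_fin ler_expR /K; lra.
have k2 := kappa_ge2 k.
have := @mgf_step k 0 setT (@measurableT _ (g_sigma_algebraType (G k))).
under eq_integral do rewrite addr0.
under [X in (_ <= X)%E -> _]eq_integral do rewrite addr0.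
move=> /le_trans; apply.
set gam := 1 - _; set rho := L / _.
have gam01 : 0 <= gam <= 1.
  rewrite /gam; apply/andP; split; last by rewrite gerBl invr_ge0; lra.
  by rewrite subr_ge0 invf_le1; lra.
have rhoK : gam * K + rho <= K.
  have kB : kappa k + 1 = k%:R + B by rewrite /kappa subrK.
  rewrite /gam /rho /K -kB invfM mulrA.
  have : (kappa k + 1)^-1 <= (kappa k)^-1 by rewrite lef_pV2 ?posrE; lra.
  have : 0 < (kappa k)^-1 by rewrite invr_gt0; lra.
  move: (L / mu) (kappa k)^-1 (kappa k + 1)^-1 Lmu0 V0 V00.
  by move=> l p q l0 v v0 p0 qp; nra.
have mV : measurable_fun setT (fun w => expR (V k w)).
  apply: (sub_measurable_fun (@G_measurable k)).
  rewrite (_ : (fun _ => _) = fun w => expR (V k w + 0)).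
    exact: expVD_measurable.
  by apply/funext => w; rewrite addr0.
apply: (@le_trans _ _
  (\int[P]_w (gam%:E * (expR (V k w))%:E + ((1 - gam) * expR K)%:E))%E).
  apply: ge0_le_integral => //.
  - apply/measurable_EFinP; apply: (sub_measurable_fun (@G_measurable k)).
    exact: expV_measurable.
  - apply: emeasurable_funD; last exact/measurable_EFinP.
    by apply/measurable_EFinP; exact: measurable_funM.
  - move=> w _; rewrite -EFinM -EFinD lee_fin.
    (* The drift is absorbed into [(1 - gam) * K], which turns the exponent into a convex
       combination of [V k w] and [K]. *)
    apply: (@le_trans _ _ (expR (gam * V k w + (1 - gam) * K))).
      by rewrite ler_expR lerD2l mulrBl mul1r lerBrDl.
    by apply: expR_convex; [lra|lra|rewrite addrC subrK].
rewrite ge0_integralD//; first last.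
- by move=> w _; rewrite lee_fin mulr_ge0 ?expR_ge0//; lra.
- by apply/measurable_EFinP; exact: measurable_funM.
- by move=> w _; rewrite -EFinM lee_fin mulr_ge0 ?expR_ge0//; lra.
rewrite ge0_integralZl_EFin//; [|exact/measurable_EFinP|lra].
apply: (@le_trans _ _ (gam%:E * (expR K)%:E + ((1 - gam) * expR K)%:E * 1)%E).
  apply: leeD; first by apply: lee_wpmul2l => //; rewrite lee_fin; lra.
  rewrite integral_cst//; apply: lee_wpmul2l; last exact: probability_le1.
  by rewrite lee_fin mulr_ge0 ?expR_ge0//; lra.
rewrite mule1 -EFinM -EFinD lee_fin -mulrDl addrC subrK mul1r//.
Qed.

(** Each drift [L / (mu (n + k + B))] of the block is at most [L / (mu n)], the growth of the
    correction per step, and [(1 - 1/kappa) V <= V], so the corrected exponential is a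
    supermartingale. Its initial mean is that of [exp V_n], at most [exp K]. *)
Lemma block_bound n (lam : R) : (0 < n)%N -> 0 < lam ->
  (P [set w | exists2 k, (k < n)%N &
      (lam < expR (V (n + k) w - L / mu * (k%:R / n%:R)))%R] <=
    (expR K / lam)%:E)%E.
Proof.
move=> n0 lam0.
have n0' : 0 < n%:R :> R by rewrite ltr0n.
pose M k w := expR (V (n + k) w - L / mu * (k%:R / n%:R)).
have Lmu0 : 0 < L / mu by rewrite divr_gt0.
have B0 : 0 < B by rewrite (lt_le_trans _ B_ge3).
have mM k : measurable_in (G (n + k)) (M k) by exact: expVD_measurable.
have super k A : <<s G (n + k) >> A ->
    (\int[P]_(w in A) (M k.+1 w)%:E <= \int[P]_(w in A) (M k w)%:E)%E.
  move=> GA; have mA := G_measurable GA.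
  rewrite /M addnS; apply: (le_trans (mgf_step _ GA)).
  apply: ge0_le_integral => //.
  - apply/measurable_EFinP/measurable_funTS.
    apply: (sub_measurable_fun (@G_measurable (n + k))).
    exact: expV_measurable.
  - apply/measurable_EFinP/measurable_funTS.
    exact: (sub_measurable_fun (@G_measurable (n + k)) (mM k)).
  - move=> w _; rewrite lee_fin ler_expR; apply: lerD.
      by rewrite ler_piMl// gerBl invr_ge0 (le_trans _ (kappa_ge2 _)).
    have -> : k.+1%:R / n%:R = k%:R / n%:R + n%:R^-1 :> R.
      by rewrite -(@natr1 R k) mulrDl mul1r.
    rewrite [L / mu * (_ + _)]mulrDr opprD addrCA gerDl subr_le0 invfM mulrA.
    rewrite ler_pM2l//.
    rewrite lef_pV2 ?posrE//; last by rewrite ltr_wpDl.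
    by rewrite natrD -addrA lerDl addr_ge0// ltW.
have h : (lam%:E * P [set w | exists2 k, (k < n)%N & (lam < M k w)%R] <=
    (expR K)%:E)%E.
  apply: (le_trans (@maximal_inequality R dO Omega P (fun k => G (n + k)%N) M
    lam n (fun k => @G_measurable (n + k)) _ mM _ (ltW lam0) super)).
  - by move=> k; rewrite addnS; exact: G_mono.
  - by move=> k w; exact: expR_ge0.
  apply: le_trans (mgf_bound n); rewrite le_eqVlt; apply/orP; left; apply/eqP.
  by apply: eq_integral => w _; rewrite /M addn0 mul0r mulr0 subr0.
by rewrite EFinM lee_pdivlMr// muleC.
Qed.
(** The threshold is [exp K] divided by the failure probability [beta / (j + 1)^2] allotted to block
    [j]; [k] counts from the start [2 ^ j] of the block. *)
Let bad (beta : R) j := [set w | exists2 k, (k < 2 ^ j)%N &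
  (expR K * (j.+1%:R ^+ 2 / beta) <
   expR (V (2 ^ j + k) w - L / mu * (k%:R / (2 ^ j)%:R)))].

(** The term [32 L] is [16 mu] times two copies of [L / mu], one inside [K] and one for the drift
    within the block. The block index is at most [log_2 k], which gives the logarithm its stated
    form. *)
Lemma gap_le_of_not_bad (beta : R) k w : 0 < beta -> (0 < k)%N ->
  ~ bad beta (trunc_log 2 k) w ->
  gap k w <=
    (16 * mu * ln ((ln k%:R / ln 2 + 1) ^+ 2 / beta)
      + mu ^+ 2 * B * (f x0 - fstar) + 32 * L) / (mu ^+ 2 * (k%:R + B - 1)).
Proof.
move=> beta0 k0; set j := trunc_log 2 k => notbad.
have kj : (2 ^ j <= k)%N by exact: trunc_logP.
have kj1 : (k < 2 ^ j.+1)%N by exact: trunc_log_ltn.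
have j0 : (0 : R) < (2 ^ j)%:R by rewrite ltr0n expn_gt0.
have Lmu0 : 0 < L / mu by rewrite divr_gt0.
have kap0 : 0 < kappa k by rewrite (lt_le_trans _ (kappa_ge2 k)).
have X0 : 0 < j.+1%:R ^+ 2 / beta :> R by rewrite divr_gt0// exprn_gt0.
have Vle : V k w <= K + ln (j.+1%:R ^+ 2 / beta) + L / mu.
  have {notbad} : ~~ (expR K * (j.+1%:R ^+ 2 / beta) <
      expR (V (2 ^ j + (k - 2 ^ j)) w -
        L / mu * ((k - 2 ^ j)%:R / (2 ^ j)%:R))).
    apply/negP => h; apply: notbad; exists (k - 2 ^ j)%N => //.
    by rewrite ltn_subLR// addnn -mul2n -expnS.
  rewrite -leNgt subnKC// -[X in _ <= _ * X]lnK ?posrE// -expRD ler_expR.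
  rewrite lerBlDr => /le_trans; apply; rewrite lerD2l ler_piMr ?ltW//.
  by rewrite ltr_pdivrMr// mul1r ltr_nat ltn_subLR// addnn -mul2n -expnS.
have lnle : ln (j.+1%:R ^+ 2 / beta) <= ln ((ln k%:R / ln 2 + 1) ^+ 2 / beta).
  have ln2 : 0 < ln 2 :> R by rewrite ln_gt0// ltr1n.
  have jle : j%:R <= ln k%:R / ln 2 :> R.
    rewrite ler_pdivlMr// mulr_natl -lnXn// -natrX.
    by rewrite ler_ln ?posrE ?ltr0n ?expn_gt0// ler_nat.
  have j1 : j.+1%:R <= ln k%:R / ln 2 + 1 :> R by rewrite -(@natr1 R j) lerD2r.
  have j10 : 0 < j.+1%:R :> R by [].
  rewrite ler_ln ?posrE//; last first.
    by rewrite divr_gt0// exprn_gt0// (lt_le_trans j10).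
  rewrite ler_pM2r ?invr_gt0// ler_pXn2r// nnegrE//.
  by rewrite (le_trans (ltW j10)).
have x00 : 0 <= f x0 - fstar by rewrite subr_ge0; case: fstar_min.
rewrite ler_pdivlMr; last by rewrite mulr_gt0// exprn_gt0.
have -> : gap k w * (mu ^+ 2 * (k%:R + B - 1)) = 16 * mu * V k w.
  by rewrite /V -/(kappa k); field.
apply: (@le_trans _ _ (16 * mu *
    (V0 + 2 * (L / mu) + ln ((ln k%:R / ln 2 + 1) ^+ 2 / beta)))).
  rewrite ler_pM2l ?mulr_gt0//; move: Vle lnle; rewrite /K; lra.
have -> : V0 = mu * (B - 1) / 16 * (f x0 - fstar) by rewrite /V0 /kappa add0r.
move: (ln (_ / beta)) => l.
(* [V0] carries the factor [B - 1] where the bound has [B]; the surplus [mu^2 Delta_0] is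
   nonnegative and is dropped. *)
have -> : 16 * mu * (mu * (B - 1) / 16 * (f x0 - fstar) + 2 * (L / mu) + l) =
  16 * mu * l + mu ^+ 2 * B * (f x0 - fstar) + 32 * L -
  mu ^+ 2 * (f x0 - fstar).
  by field; rewrite gt_eqF.
by rewrite gerBl mulr_ge0// sqr_ge0.
Qed.

Lemma bad_measurable beta j : measurable (bad beta j).
Proof.
pose H k w := expR (V (2 ^ j + k) w - L / mu * (k%:R / (2 ^ j)%:R)).
rewrite (_ : bad beta j = \bigcup_(k in `I_(2 ^ j))
    [set w | expR K * (j.+1%:R ^+ 2 / beta) < H k w]); last first.
  by apply/seteqP; split=> w [k]; exists k.
apply: bigcup_measurable => k _.
have mH : measurable_fun setT (H k).
  apply: (sub_measurable_fun (@G_measurable (2 ^ j + k))).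
  exact: expVD_measurable.
have := mH measurableT _
  (measurable_itv `](expR K * (j.+1%:R ^+ 2 / beta)), +oo[).
rewrite setTI; congr measurable.
by apply/seteqP; split=> w /=; rewrite in_itv/= andbT.
Qed.

Lemma sgd_anytime_bound (beta : R) : 0 < beta ->
  ((1 - pi ^+ 2 * beta / 6)%:E <=
   P [set w | forall k : nat, (0 < k)%N ->
        (f (x k w) - fstar <=
          (16 * mu * ln ((ln k%:R / ln 2 + 1) ^+ 2 / beta)
             + mu ^+ 2 * B * (f x0 - fstar) + 32 * L)
          / (mu ^+ 2 * (k%:R + B - 1)))%R])%E.
Proof.
move=> beta0.
have bad_le j : (P (bad beta j) <= (beta * (j.+1%:R ^+ 2)^-1)%:E)%E.
  have lam0 : 0 < expR K * (j.+1%:R ^+ 2 / beta).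
    by rewrite mulr_gt0 ?expR_gt0// divr_gt0// exprn_gt0.
  have n0 : (0 < 2 ^ j)%N by rewrite expn_gt0.
  apply: (le_trans (block_bound n0 lam0)); rewrite lee_fin invfM mulrA.
  by rewrite mulfV ?gt_eqF ?expR_gt0// mul1r invfM invrK mulrC.
have mbad j := bad_measurable beta j.
have mU : measurable (\bigcup_j bad beta j) by exact: bigcupT_measurable.
have Ule : (P (\bigcup_j bad beta j) <= (pi ^+ 2 * beta / 6)%:E)%E.
  apply: (le_trans (measure_sigma_subadditive _ mbad mU _)) => //.
  (* Bounding the partial sums is enough, and [basel_le] holds for each of them. *)
  apply: lime_le; first by apply: is_cvg_nneseries => j _ _; exact: measure_ge0.
  near=> N.
  apply: (@le_trans _ _ (\sum_(0 <= j < N) (beta * (j.+1%:R ^+ 2)^-1)%:E)%E).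
    by apply: lee_sum => j _; exact: bad_le.
  rewrite sumEFin lee_fin -mulr_sumr [leRHS]mulrAC [leRHS]mulrC ler_pM2l//.
  exact: basel_le.
have mgap_le k (c : R) : measurable [set w | gap k w <= c].
  have mgap : measurable_fun setT (gap k).
    by apply: (sub_measurable_fun (@G_measurable k)); exact: gap_measurable.
  by have := mgap measurableT _ (measurable_itv `]-oo, c]); rewrite setTI.
apply: (@le_trans _ _ (P (~` \bigcup_j bad beta j))).
  rewrite probability_setC// EFinB; apply: leeB => //.
apply: le_measure; rewrite ?inE.
- exact: measurableC.
- rewrite (_ : [set w | _] = \bigcap_(k in [set k | (0 < k)%N])
    [set w | gap k w <=
      (16 * mu * ln ((ln k%:R / ln 2 + 1) ^+ 2 / beta)
        + mu ^+ 2 * B * (f x0 - fstar) + 32 * L) / (mu ^+ 2 * (k%:R + B - 1))]).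
    by apply: bigcap_measurable => [|k _]; [exists 1%N|exact: mgap_le].
  by apply/seteqP; split.
- move=> w nb k k0; apply: gap_le_of_not_bad => // bw.
  by apply: nb; exists (trunc_log 2 k).
Unshelve. all: by end_near. Qed.
End sgd.

Theorem theorem1 (R : realType) (d : nat)
    (f : 'rV[R]_d -> R) (mu L fstar : R)
    (mu_gt0 : 0 < mu) (L_gt0 : 0 < L)
    (f_strongly_convex : strongly_convex mu f)
    (f_smooth : smooth L f)
    (fstar_min : is_minimum f fstar)
    (dO dX : measure_display)
    (Omega : measurableType dO) (X : measurableType dX)
    (P : probability Omega R)
    (xi : nat -> Omega -> X)
    (xi_measurable : forall k, measurable_fun setT (xi k))
    (g : 'rV[R]_d -> X -> 'rV[R]_d)
    (B : R) (B_def : B = Num.max (4 * L / mu) 3)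
    (eta : nat -> R) (eta_def : forall k, eta k = 4 / (mu * (k%:R + B)))
    (t_ : nat -> R) (t_def : forall k, t_ k = mu * (k%:R + B - 1) / 16)
    (x0 : 'rV[R]_d) (x : nat -> Omega -> 'rV[R]_d)
    (x_init : forall w, x 0%N w = x0)
    (x_step : forall k w,
      x k.+1 w = x k w - eta k *: g (x k w) (xi k w))
    (g_measurable : forall k i,
      measurable_wrt (past xi k.+1) (fun w => g (x k w) (xi k w) 0 i))
    (g_unbiased : forall k i,
      is_condexp P (past xi k)
        (fun w => g (x k w) (xi k w) 0 i) (fun w => grad f (x k w) 0 i))
    (g_light_tailed : forall (k : nat) (t : R), 0 < t < 1 / 2 ->
      condexp_le P (past xi k)
        (fun w => expR (t * enorm (g (x k w) (xi k w) - grad f (x k w)) ^+ 2))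
        (1 / Num.sqrt (1 - 2 * t)))
    (beta : R) (beta_range : 0 < beta < 6 / pi ^+ 2) :
  ((1 - pi ^+ 2 * beta / 6)%:E <=
   P [set w | forall k : nat, (0 < k)%N ->
        (f (x k w) - fstar <=
          (16 * mu * ln ((ln k%:R / ln 2 + 1) ^+ 2 / beta)
             + mu ^+ 2 * B * (f x0 - fstar) + 32 * L)
          / (mu ^+ 2 * (k%:R + B - 1)))%R])%E.
Proof.
have [LB B3] : 4 * L / mu <= B /\ 3 <= B.
  by rewrite B_def /Num.max; case: ltP => [/ltW|].
have BL : 4 * L <= mu * B by rewrite -ler_pdivrMl// mulrC.
(* By definition [past xi k] is generated by [G k], so the hypotheses fit the abstract filtration as
   they stand. *)
pose G k := \bigcup_(i in `I_k) preimage_set_system setT (xi i) measurable.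
apply: (@sgd_anytime_bound R d f mu L fstar mu_gt0 L_gt0 f_strongly_convex
  f_smooth fstar_min dO Omega P G (fun k => past_measurable xi_measurable)
  (@past_mono _ _ _ _ xi) B B3 BL x0 x (fun k w => g (x k w) (xi k w)) x_init _
  g_measurable g_unbiased g_light_tailed).
  by move=> k w; rewrite x_step eta_def.
by case/andP: beta_range.
Qed.
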